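(* Let $\mathcal{K}=\{x\in\mathbb{R}^n: g_1(x)\ge 0,\ldots,g_q(x)\ge 0\}$ be a basic semialgebraic set, and let $B^*$ and $B^*_{d,\nu}$ be the optimal values of the polynomial matrix inequality problem and of its sparsity-exploiting SOS reformulation defined in the context. Suppose that $P(x,\lambda)$ and the polynomials $g_1,\ldots,g_q$ defining $\mathcal{K}$ are homogeneous of even degree in $x$ for all $\lambda$. If there exists $\lambda_0 \in \mathbb{R}^\ell$ such that $P(x, \lambda_0)$ is strictly positive definite on $\mathcal{K}\setminus \{0\}$, then $B_{d,\nu}^* \to B^*$ from above as $\nu \to \infty$ with $d = \nu + \frac12 \max\{\deg(P), \deg(g_1), \ldots, \deg(g_q)\}$ and $\sigma(x) = \|x\|^2$.
   Context: Polynomials have real coefficients, $x=(x_1,\ldots,x_n)$, $\|x\|^2=x_1^2+\cdots+x_n^2$. Let $b:\mathbb{R}^\ell\to\mathbb{R}$ be convex, let $P_0,\ldots,P_\ell$ be $m\times m$ symmetric polynomial matrices in $x$, let $P(x,\lambda):=P_0(x)-\sum_{i=1}^\ell P_i(x)\lambda_i$ for $\lambda\in\mathbb{R}^\ell$, and let $g_1,\ldots,g_q$ be the polynomials defining $\mathcal{K}$. A polynomial matrix is homogeneous if all its entries are homogeneous of the same degree (zero entries allowed). The polynomial matrix inequality problem is $$B^* := \inf_{\lambda\in\mathbb{R}^\ell} b(\lambda)\quad\text{s.t.}\quad P(x,\lambda)\succeq 0\ \ \forall x\in\mathcal{K}.$$ The sparsity graph of $P$ is the undirected graph with vertices $\{1,\ldots,m\}$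 in which, for $i\neq j$, $(i,j)$ is not an edge if and only if $P_{ij}(x,\lambda)$ vanishes identically (in $x$ and $\lambda$). It is assumed to be chordal (every cycle of length at least $4$ has an edge joining two nonconsecutive vertices), with maximal cliques $\mathcal{C}_1,\ldots,\mathcal{C}_t$ (a clique is a set of pairwise adjacent vertices; it is maximal if not contained in another clique). For a clique $\mathcal{C}$ with elements $\mathcal{C}(1)<\cdots<\mathcal{C}(|\mathcal{C}|)$, $E_{\mathcal{C}}\in\mathbb{R}^{|\mathcal{C}|\times m}$ has $(E_{\mathcal{C}})_{ij}=1$ if $\mathcal{C}(i)=j$ and $0$ otherwise. A polynomial matrix $S(x)$ is SOS if $S=H^{\mathsf T}H$ for some (possibly rectangular) polynomial matrix $H$. $\Sigma^{p}_{2\omega}$ denotes the cone of $p\times p$ SOS matrices in $n$ variables of degree at most $2\omega$. For integers $\nu\ge 0$ and $d$ with $2d\ge\max\{\deg(P),\deg(g_1),\ldots,\deg(g_q)\}+2\nu$ (degrees in $x$) and a polynomial $\sigma$, the SOS reformulation is $$B_{d,\nu}^* := \inf_{\lambda,\,S_{j,k}} b(\lambda)\quad\text{s.t.}\quad \sigma(x)^\nu P(x,\lambda)=\sum_{k=1}^t E_{\mathcal{C}_k}^{\mathsf T}\Big(S_{0,k}(x)+\sum_{j=1}^q g_j(x)S_{j,k}(x)\Big)E_{\mathcal{C}_k},\quad S_{j,k}\in\Sigma^{|\mathcal{C}_k|}_{2d_j}\ \ (j=0,\ldots,q,\ k=1,\ldots,t),$$ where $d_0:=d$ and $d_j:=d-\lceil\tfrac12\deg(g_j)\rceil$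 for $j=1,\ldots,q$. The infimum over an empty set is $+\infty$.
   Formalization: The formal theorem additionally assumes deg(P) > 0 when K = {0}; without this the claim fails, e.g. n = m = 1, g = -x^2, P = -1, where B* is +infinity but the SOS reformulation is feasible for every nu ≥ 1. *)

(* Defs.v *)
From HB Require Import structures.
From mathcomp Require Import all_boot all_order all_algebra.
From mathcomp Require Import boolp classical_sets reals constructive_ereal ereal.
From mathcomp Require Import topology convex.
(* The notations of mpoly clash with those of mathcomp-analysis, hence
   they are left out. *)
From mathcomp Require mpoly.
Import -(notations) mpoly.

Set Implicit Arguments.
Unset Strict Implicit.
Unset Printing Implicit Defensive.

Import Order.TTheory GRing.Theory Num.Theory.

Local Open Scope classical_set_scope.
Local Open Scope ring_scope.

Notation mpolynomial R n := (mpoly.mpoly n R).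

Section Graphs.
Variables (T : finType) (e : rel T).

(* The graph is given by its adjacency relation; a cycle is a duplicate-free
   cyclic sequence of vertices, and a chord joins two vertices neither of which
   follows the other in it. *)
Definition chordal : Prop :=
  forall c : seq T, uniq c -> cycle e c -> (4 <= size c)%N ->
    exists x y : T,
      [/\ x \in c, y \in c, e x y, y != next c x & x != next c y].

Definition clique : pred {set T} :=
  fun C => [forall x in C, forall y in C, (x != y) ==> e x y].

Definition maximal_clique : pred {set T} := fun C => maxset clique C.

End Graphs.

(* [enum_val] lists the elements of [C : {set 'I_m}] in increasing order. *)
Definition clique_mx (A : nzRingType) (m : nat) (C : {set 'I_m}) :
    'M[A]_(#|C|, m) :=
  \matrix_(i, j) (enum_val i == j)%:R.

Section QuadraticForms.
Variables (R : realType) (m : nat).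

(* Only used for symmetric matrices. *)
Definition pos_semidef (A : 'M[R]_m) : Prop :=
  forall v : 'cV[R]_m, 0 <= (v^T *m A *m v) 0 0.

Definition pos_def (A : 'M[R]_m) : Prop :=
  forall v : 'cV[R]_m, v != 0 -> 0 < (v^T *m A *m v) 0 0.

End QuadraticForms.

Section Polynomials.
Variables (R : realType) (n : nat).

(* The zero polynomial gets degree 0. *)
Definition pdeg (p : mpolynomial R n) : nat :=
  (mpoly.mmeasure mpoly.mdeg p).-1.

Definition peval (p : mpolynomial R n) (x : 'rV[R]_n) : R :=
  mpoly.meval (fun i => x 0 i) p.

(* The zero polynomial is homogeneous of every degree. *)
Definition homogeneous (k : nat) (p : mpolynomial R n) : Prop :=
  p \is mpoly.ishomog1 k mpoly.mdeg.

Definition even_homogeneous (p : mpolynomial R n) : Prop :=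
  exists2 k : nat, ~~ odd k & homogeneous k p.

Definition sqnormX : mpolynomial R n :=
  \sum_(i < n) mpoly.mpolyX R (mpoly.mnm1 i) ^+ 2.

Definition mxdeg (p r : nat) (M : 'M[mpolynomial R n]_(p, r)) : nat :=
  \max_(i < p) \max_(j < r) pdeg (M i j).

Definition mxeval (p : nat) (M : 'M[mpolynomial R n]_p) (x : 'rV[R]_n) :
    'M[R]_p :=
  \matrix_(i, j) peval (M i j) x.

Definition even_homogeneous_mx (p : nat) (M : 'M[mpolynomial R n]_p) : Prop :=
  exists2 k : nat, ~~ odd k & forall i j, homogeneous k (M i j).

Definition sos_mx (p : nat) (S : 'M[mpolynomial R n]_p) : Prop :=
  exists (r : nat) (H : 'M[mpolynomial R n]_(r, p)), S = H^T *m H.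

(* The cone of p x p SOS matrices of degree at most 2w. *)
Definition sos_cone (p w : nat) : set 'M[mpolynomial R n]_p :=
  [set S | sos_mx S /\ (mxdeg S <= w.*2)%N].

Definition semialgebraic_set (q : nat) (g : 'I_q -> mpolynomial R n) :
    set 'rV[R]_n :=
  [set x | forall j, 0 <= peval (g j) x].

End Polynomials.

Section PolynomialMatrixInequality.
Variables (R : realType) (n m l q : nat).
Variables (b : 'rV[R]_l -> R).
Variables (P0 : 'M[mpolynomial R n]_m) (Ps : 'I_l -> 'M[mpolynomial R n]_m).
Variables (g : 'I_q -> mpolynomial R n).

Definition pencil (lam : 'rV[R]_l) : 'M[mpolynomial R n]_m :=
  P0 - \sum_(i < l) mpoly.mpolyC n (lam 0 i) *: Ps i.

(* The degree in x of P(x, lambda), lambda being indeterminate. *)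
Definition pencil_deg : nat := maxn (mxdeg P0) (\max_(i < l) mxdeg (Ps i)).

Definition sparsity_graph : rel 'I_m :=
  fun i j => (i != j) && ~~ `[< forall lam, pencil lam i j = 0 >].

Definition pmi_feasible : set 'rV[R]_l :=
  [set lam | forall x, semialgebraic_set g x ->
                       pos_semidef (mxeval (pencil lam) x)].

(* The infimum of the empty set is +oo. *)
Definition pmi_value : \bar R := ereal_inf [set (b lam)%:E | lam in pmi_feasible].

(* The cliques C_1, ..., C_t are the sets C satisfying [maximal_clique]; they
   serve as their own index, and the values of S0 and S at other sets are
   irrelevant. The subtraction d - ceil(deg(g_j) / 2) is not truncated when
   2d is at least the degree of each g_j. *)
Definition sos_feasible (sigma : mpolynomial R n) (d nu : nat) :
    set 'rV[R]_l :=
  [set lam | exists (S0 : forall C : {set 'I_m}, 'M[mpolynomial R n]_#|C|)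
                    (S : 'I_q -> forall C : {set 'I_m},
                                   'M[mpolynomial R n]_#|C|),
     [/\ forall C, maximal_clique sparsity_graph C -> sos_cone d (S0 C),
         forall j C, maximal_clique sparsity_graph C ->
           sos_cone (d - uphalf (pdeg (g j))) (S j C)
       & sigma ^+ nu *: pencil lam =
         \sum_(C : {set 'I_m} | maximal_clique sparsity_graph C)
            (clique_mx _ C)^T *m (S0 C + \sum_(j < q) g j *: S j C)
                             *m clique_mx _ C]].

Definition sos_value (sigma : mpolynomial R n) (d nu : nat) : \bar R :=
  ereal_inf [set (b lam)%:E | lam in sos_feasible sigma d nu].

End PolynomialMatrixInequality.

(* Main.v *)
(* For P(x, lam) positive definite on K \ {0}, the relaxation is feasible at lam
   for all large nu; convexity of b along the segment to lam0 then gives the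
   limit. To see the feasibility, linearize: every product x_i x_j is a linear
   combination of the squares z = (x_i + x_j)^2 / 4n, (x_i - x_j)^2 / 4n, whose
   sum is |x|^2, and the points z of the standard simplex which come from a
   point of the sphere are cut out by polynomial equations. Subtracting from P
   multiples h (M - h)^(2k) of these equations (as h = - r^2) and of the g_j
   makes P, lifted to a form in z, positive definite on the whole simplex
   without changing its sparsity pattern. By Polya's theorem for matrices, its
   product with a power of sum z is a combination of monomials in z with
   constant positive semidefinite coefficients. By chordality each coefficient
   is a sum of matrices u u^T with u supported in a clique, and the monomials
   become squares upon substituting back z = z(x). *)
From HB Require Import structures.
Require Import Defs.
From mathcomp Require Import all_boot all_order all_algebra.
From mathcomp Require Import boolp classical_sets reals constructive_ereal ereal.
From mathcomp Require Import topology normedtype derive realfun convex sequences.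
From mathcomp Require Import ring lra zify.
From mathcomp Require mpoly.
Import -(notations) mpoly.

Set Implicit Arguments.
Unset Strict Implicit.
Unset Printing Implicit Defensive.

Import Order.TTheory GRing.Theory Num.Theory.
Import numFieldNormedType.Exports.

Local Open Scope ring_scope.

(** Polya's theorem concerns nonnegative variables, whereas the coordinates of x take both signs;
    hence the passage to squares of linear forms. An even form of degree 2k in x lifts to a form of
    degree k in z, and this is why the certificate meets the prescribed degree: a monomial of degree
    nu + deg(P)/2 in z pulls back to the square of a polynomial of that same degree in x. The price
    is that the points z(x) fill only a part of the simplex, while Polya needs positivity on all of
    it. The penalty that closes this gap is shaped by the certificate: (M - h)^(2k) is a square, so
    its product with the identity matrix is an admissible multiplier of g_j, and being diagonal it
    needs no edge of the graph. Powers of sum z, which equal 1 on the simplex, bring all terms to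
    one common degree. In the other direction, an identity carrying the factor |x|^(2 nu) says
    nothing at x = 0, where homogeneity in x takes over. *)

(** * Simplicial vertices of chordal graphs (Dirac) *)

Section Simplicial.
Variables (T : finType) (e : rel T).
Hypotheses (e_sym : ssrbool.symmetric e) (e_irr : irreflexive e).
Hypothesis e_chordal : chordal e.

Lemma next_mid (a b : seq T) (x y : T) :
  uniq (a ++ x :: y :: b) -> next (a ++ x :: y :: b) x = y.
Proof.
by move=> u; rewrite -(next_rot (size a) u) rot_size_cat /= eqxx.
Qed.

Lemma next_last (a : seq T) (x y : T) :
  uniq (y :: rcons a x) -> next (y :: rcons a x) x = y.
Proof.
rewrite -rcons_cons -cats1 => u.
by rewrite -(next_rot (size (y :: a)) u) rot_size_cat /= eqxx.
Qed.

(* A shortest path from s to t through C closes up with v to a cycle without a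
   chord, unless it is a single edge. *)
Lemma separator_adjacent (C : {set T}) (v s t : T) (q : seq T) :
  v \notin C -> (forall x, x \in C -> ~~ e v x) -> e v s -> e v t -> s != t ->
  (forall x, x \in q -> x = t \/ x \in C) ->
  uniq (s :: q) -> path e s q -> last s q = t -> e s t.
Proof.
move=> vC vNC evs evt st.
have [k] := ubnP (size q); elim: k q => // k IH q; rewrite ltnS => qk qC uq pq lq.
have v_s : v != s by apply: contraTneq evs => ->; rewrite e_irr.
have v_t : v != t by apply: contraTneq evt => ->; rewrite e_irr.
have vq : v \notin s :: q.
  rewrite in_cons negb_or v_s /=; apply/negP => /qC [vt|]; last exact/negP.
  by rewrite vt eqxx in v_t.
have uc : uniq (v :: s :: q) by rewrite cons_uniq vq.
have cc : cycle e (v :: s :: q).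
  by rewrite /= evs rcons_path pq lq /= e_sym.
have [sz|sz] := leqP 2 (size q); last first.
  case: q {qk qC uq cc uc vq} sz pq lq => [_ _ /= st'|x [|//] _ /= ex lx].
    by rewrite st' eqxx in st.
  by rewrite -lx; case/andP: ex.
(* A chord between two vertices of the path skips [b], which is nonempty because [y] does not follow
   [x]; the induction hypothesis applies to the shorter path. *)
have shortcut x y a b d : s :: q = a ++ x :: b ++ y :: d -> e x y ->
    y != next (v :: s :: q) x -> e s t.
  move=> Eq exy yn.
  have bne : (0 < size b)%N.
    rewrite lt0n size_eq0; apply: contraNneq yn => b0.
    rewrite Eq b0 (_ : next _ x = y) //; apply: (@next_mid (v :: a) d x y).
    by move: uc; rewrite Eq b0.
  have [q' Eq'] : exists q', a ++ x :: y :: d = s :: q'.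
    by case: a Eq => [|z a] [-> _]; eexists; reflexivity.
  have sub : subseq (s :: q') (s :: q).
    by rewrite -Eq' Eq; apply: cat_subseq => //=; rewrite eqxx suffix_subseq.
  apply: (IH q').
  - have := congr1 size Eq'; have := congr1 size Eq.
    rewrite !size_cat /= !size_cat /= => h1 h2.
    by move: qk h1 h2 bne; clear; lia.
  - move=> z zq; have := mem_subseq sub (mem_behead (s := s :: q') zq).
    rewrite in_cons => /orP[/eqP zs|]; last exact: qC.
    have := subseq_uniq sub uq.
    by rewrite /= -zs zq.
  - exact: subseq_uniq sub uq.
  - have : sorted e (s :: q) by [].
    rewrite -[path e s q']/(sorted e (s :: q')) -Eq' Eq.
    case: (a) => [|z a'] /=; rewrite !cat_path /= ?cat_path /=.
      by case/and3P=> _ _ ->; rewrite exy.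
    by case/and5P=> -> -> _ _ ->; rewrite exy.
  - rewrite -lq -[last s q']/(last s (s :: q')) -Eq' -[last s q]/(last s (s :: q)) Eq.
    by rewrite !last_cat /= last_cat.
have [x [y [xc yc exy ynx xny]]] : exists x y : T, [/\ x \in v :: s :: q,
    y \in v :: s :: q, e x y, y != next (v :: s :: q) x & x != next (v :: s :: q) y].
  exact: e_chordal.
(* No chord ends at [v]: its only neighbours on the cycle are [s] and [t], which are next to it. *)
have noV y0 : e v y0 -> y0 \in v :: s :: q ->
    y0 != next (v :: s :: q) v -> v != next (v :: s :: q) y0 -> False.
  rewrite !in_cons => evy /or3P[/eqP y0v|/eqP ->|/qC [->|yC]].
  - by rewrite y0v e_irr in evy.
  - by rewrite /= eqxx eqxx.
  - move=> _; move: uc lq; rewrite -[last s q]/(last v (s :: q)).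
    case/lastP: (s :: q) => [|a z]; first by move=> _ /= E; rewrite E eqxx in v_t.
    by rewrite last_rcons => u <-; rewrite next_last // eqxx.
  - by rewrite (negPf (vNC _ yC)) in evy.
have xv : x != v by apply/eqP => E; subst x; case: (noV y).
have yv : y != v by apply/eqP => E; subst y; case: (noV x) => //; rewrite e_sym.
rewrite in_cons (negPf xv) /= in xc; rewrite in_cons (negPf yv) /= in yc.
have Hxy : x != y by apply: contraTneq exy => ->; rewrite e_irr.
have [a [b Eq]] : exists a b, s :: q = a ++ x :: b.
  by case/splitPr: xc => a b; exists a, b.
have : y \in a ++ x :: b by rewrite -Eq.
rewrite mem_cat in_cons eq_sym (negPf Hxy) /= => /orP[ya|yb].
  case/splitPr: ya Eq => a1 a2; rewrite -catA /= => Eq.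
  by apply: shortcut Eq _ _ => //; rewrite e_sym.
by case/splitPr: yb Eq => b1 b2 Eq; apply: shortcut Eq _ _.
Qed.

Definition simplicial (V : {set T}) (w : T) : Prop :=
  w \in V /\ forall x y, x \in V -> y \in V -> e w x -> e w y -> x != y -> e x y.

(* Removing v and its neighbours, take a component C of what is left, and the
   set S of the neighbours of v adjacent to C. As S is a clique, a simplicial
   vertex of C :|: S lying in C can be found, and it is simplicial in V. *)
Lemma simplicial_far (V : {set T}) (v u : T) :
  v \in V -> u \in V -> u != v -> ~~ e v u ->
  exists w, [/\ w != v, ~~ e v w & simplicial V w].
Proof.
have [k] := ubnP #|V|; elim: k V v u => // k IH V v u; rewrite ltnS => Vk vV uV uv evu.
pose W := [set x in V | (x != v) && ~~ e v x].
pose r := [rel x y | [&& e x y, x \in W & y \in W]].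
have r_sym : ssrbool.symmetric r by move=> x y /=; rewrite e_sym andbCA andbC -andbA andbC -!andbA.
pose C := [set x | connect r u x].
have uW : u \in W by rewrite inE uV uv evu.
have CW x : x \in C -> x \in W.
  rewrite inE => /connectP[p]; case/lastP: p => [_ ->//|p z].
  by rewrite rcons_path last_rcons => /andP[_ /and3P[_ _ h]] ->.
pose S := [set x in V | e v x & [exists c in C, e x c]].
have uC : u \in C by rewrite inE; apply: connect0.
(* Vertices of [C] have all their neighbours in [C :|: S], so for them being simplicial there and in
   [V] is the same. *)
have nbr c x : c \in C -> x \in V -> e c x -> x \in C :|: S.
  move=> cC xV ecx; have := CW _ cC; rewrite inE => /and3P[cV cv evc].
  have [xv|xv] := eqVneq x v; first by rewrite xv e_sym (negPf evc) in ecx.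
  rewrite inE; apply/orP; have [evx|evx] := boolP (e v x).
    by right; rewrite inE xV evx; apply/existsP; exists c; rewrite cC e_sym.
  left; rewrite inE; apply: (connect_trans (y := c)); first by rewrite inE in cC.
  by apply: connect1; rewrite /= ecx CW // inE xV xv.
have vC : v \notin C by apply/negP => /CW; rewrite inE eqxx andbF.
have vNC x : x \in C -> ~~ e v x by move/CW; rewrite inE => /and3P[].
have S_adj s t : s \in S -> t \in S -> s != t -> e s t.
  rewrite !inE => /and3P[sV evs /existsP[c /andP[cC esc]]].
  move=> /and3P[tV evt /existsP[d /andP[dC etd]]] st.
  have cW := CW _ cC.
  have /connectP[p rp dp] : connect r c d.
    rewrite !inE in cC dC; apply: connect_trans dC.
    by rewrite (sym_connect_sym r_sym).
  have pC : {subset c :: p <= C}.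
    move=> x /(path_connect rp) h; rewrite !inE in cC *.
    exact: connect_trans cC h.
  have pp : path e s (rcons (c :: p) t).
    rewrite rcons_path /= esc -dp e_sym etd andbT.
    by apply: sub_path rp => x y /and3P[].
  have := last_rcons s (c :: p) t; case/shortenP: pp => q pq uq sub lq.
  apply: (separator_adjacent vC vNC evs evt st (q := q)) => //.
  move=> x /sub; rewrite mem_rcons in_cons => /orP[/eqP|]; first by left.
  by right; apply: pC.
pose G := C :|: S.
have GV : G \subset V.
  apply/fintype.subsetP => x; rewrite !inE => /orP[xC|/andP[]//].
  by have := CW x; rewrite !inE => /(_ xC) /andP[].
have Gk : (#|G| < k)%N.
  apply: leq_trans Vk; apply: proper_card; rewrite properE GV; apply/fintype.subsetPn.
  by exists v => //; rewrite finset.in_setU (negPf vC) /= inE e_irr andbF.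
have lift w : w \in C -> simplicial G w -> exists w, [/\ w != v, ~~ e v w & simplicial V w].
  move=> wC [wG ws]; exists w; have := CW _ wC; rewrite inE => /and3P[wV -> ->].
  split=> //; split=> // x y xV yV ewx ewy.
  by apply: ws => //; rewrite /G (@nbr w).
(* The induction hypothesis gives a simplicial vertex of [G] not adjacent to a chosen base, and the
   base must force it into [C]. A base in [S] does, since [S] is a clique. If no vertex of [S] can
   serve, each is adjacent to all of [G], so a base in [C] does. If none can serve there either, [G]
   is a clique and [u] itself is simplicial. *)
have [/existsP[s /andP[sS /existsP[z /and3P[zG zs esz]]]]|Suniv] :=
  boolP [exists s in S, exists z, [&& z \in G, z != s & ~~ e s z]].
  have sG : s \in G by rewrite finset.in_setU sS orbT.
  have [w [ws esw wG]] := IH _ _ _ Gk sG zG zs esz.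
  apply: (lift w) => //; case: wG => wG _; move: wG; rewrite finset.in_setU => /orP[//|wS].
  by rewrite (S_adj s w) // eq_sym in esw.
have {}Suniv s z : s \in S -> z \in G -> z != s -> e s z.
  move=> sS zG zs; apply: contraNT Suniv => esz; apply/existsP; exists s.
  by rewrite sS; apply/existsP; exists z; rewrite zG zs.
have [/existsP[c /andP[cC /existsP[z /and3P[zG zc ecz]]]]|Cuniv] :=
  boolP [exists c in C, exists z, [&& z \in G, z != c & ~~ e c z]].
  have cG : c \in G by rewrite finset.in_setU cC.
  have [w [wc ecw wG]] := IH _ _ _ Gk cG zG zc ecz.
  apply: (lift w) => //; case: wG => wG _; move: wG; rewrite finset.in_setU => /orP[//|wS].
  by rewrite e_sym (Suniv w c) // eq_sym in ecw.
apply: (lift u) => //; split=> [|x y xG yG _ _ xy]; first by rewrite finset.in_setU uC.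
have := xG; rewrite finset.in_setU => /orP[xC|xS]; last by apply: Suniv; rewrite // eq_sym.
apply: contraNT Cuniv => exy; apply/existsP; exists x; rewrite xC.
by apply/existsP; exists y; rewrite yG eq_sym xy.
Qed.

Lemma simplicial_exists (V : {set T}) : V != finset.set0 -> exists w, simplicial V w.
Proof.
case/finset.set0Pn => v0 v0V.
have [/existsP[v /andP[vV /existsP[u /and3P[uV uv evu]]]]|cl] :=
  boolP [exists v in V, exists u, [&& u \in V, u != v & ~~ e v u]].
  by have [w []] := simplicial_far vV uV uv evu; exists w.
exists v0; split=> // x y xV yV _ _ xy; apply: contraNT cl => exy.
apply/existsP; exists x; rewrite xV; apply/existsP; exists y.
by rewrite yV eq_sym xy.
Qed.

End Simplicial.

(** * Positive semidefinite matrices with a chordal sparsity pattern *)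

Section ChordalDecomposition.
Variables (R : realType) (m : nat).
Implicit Types (A : 'M[R]_m) (u v : 'cV[R]_m).
Local Notation "''d_' w" := (delta_mx w 0 : 'cV[R]_m) (at level 8, w at level 2).

Lemma form_delta A v (w : 'I_m) : A^T = A ->
  (v^T *m A *m 'd_w) 0 0 = (A *m v) w 0 /\
  (('d_w)^T *m A *m v) 0 0 = (A *m v) w 0.
Proof.
move=> As; split; last by rewrite trmx_delta -mulmxA -rowE mxE.
by rewrite -mulmxA -colE !mxE; apply: eq_bigr => i _; rewrite !mxE -{1}As mxE mulrC.
Qed.

Lemma form_shift A v (w : 'I_m) (t : R) : A^T = A ->
  ((v - t *: 'd_w)^T *m A *m (v - t *: 'd_w)) 0 0 =
  (v^T *m A *m v) 0 0 - 2 * t * (A *m v) w 0 + t ^+ 2 * A w w.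
Proof.
move=> As; have [h1 h2] := form_delta v w As.
have h3 : (('d_w)^T *m A *m 'd_w) 0 0 = A w w.
  by have [_ ->] := form_delta ('d_w) w As; rewrite -colE mxE.
have -> : (v - t *: 'd_w)^T = v^T - t *: ('d_w)^T by rewrite raddfB /= linearZ.
rewrite !mulmxBr !mulmxBl.
rewrite -?scalemxAl -?scalemxAr -?scalemxAl.
move: h1 h2 h3; rewrite !mxE => -> -> ->.
by ring.
Qed.

Lemma psd_diag_ge0 A w : A^T = A -> pos_semidef A -> 0 <= A w w.
Proof.
move=> As psd; have := psd ('d_w).
by have [-> _] := form_delta ('d_w) w As; rewrite -colE mxE.
Qed.

Lemma psd_diag_eq0 A i w : A^T = A -> pos_semidef A -> A w w = 0 -> A i w = 0.
Proof.
move=> As psd Aw; apply/eqP/negPn/negP => Aiw.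
(* With a zero diagonal entry at [w] the form is affine in the shift; this shift gives it the value
   -1. *)
have := psd ('d_i - ((A i i + 1) / (2 * A i w)) *: 'd_w).
rewrite form_shift // Aw mulr0 addr0; have [-> _] := form_delta ('d_i) i As.
rewrite -!colE !mxE -[in A w i]As mxE.
suff -> : A i i - 2 * ((A i i + 1) / (2 * A i w)) * A i w = -1 by rewrite lerNr oppr0 ler10.
by field.
Qed.

(** The form of the Schur complement at [v] is the minimum over [t] of the form of [A] at
    [v - t *: 'd_w]. *)
Lemma schur_psd A w : A^T = A -> pos_semidef A -> 0 < A w w ->
  pos_semidef (A - (A w w)^-1 *: (col w A *m (col w A)^T)).
Proof.
move=> As psd Aw v; pose t := (A *m v) w 0 / A w w.
have := psd (v - t *: 'd_w); rewrite form_shift // => h.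
suff -> : (v^T *m (A - (A w w)^-1 *: (col w A *m (col w A)^T)) *m v) 0 0 =
  (v^T *m A *m v) 0 0 - 2 * t * (A *m v) w 0 + t ^+ 2 * A w w by [].
rewrite mulmxBr mulmxBl -scalemxAr -scalemxAl [LHS]mxE -addrA; congr (_ + _).
have -> : v^T *m (col w A *m (col w A)^T) *m v =
    (v^T *m A *m 'd_w) *m (('d_w)^T *m A *m v).
  by rewrite colE trmx_mul As !mulmxA.
have [h1 h2] := form_delta v w As.
rewrite mxE mxE mxE big_ord1 h1 h2 /t.
by field; rewrite gt_eqF.
Qed.

(** Cholesky elimination at simplicial vertices causes no fill-in: the column of such a vertex [w]
    is supported in a clique, so subtracting its rank-one term alters only entries on the diagonal
    or on edges. The induction is on a set [V] outside which [A] vanishes. *)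
Lemma chordal_psd_decomp (e : rel 'I_m) A :
  ssrbool.symmetric e -> irreflexive e -> chordal e ->
  A^T = A -> pos_semidef A -> (forall i j, i != j -> ~~ e i j -> A i j = 0) ->
  exists L : seq 'cV[R]_m, A = \sum_(u <- L) u *m u^T /\
    forall u, u \in L -> clique e [set i | u i 0 != 0].
Proof.
move=> e_sym e_irr e_ch.
suff [k] : exists k, (#|[set: 'I_m]| < k)%N.
  move: [set: 'I_m] (fun i : 'I_m => finset.in_setT i) => V VT.
  have : forall i j, A i j != 0 -> (i \in V) && (j \in V) by move=> i j _; rewrite !VT.
  clear VT; elim: k V A => // k IH V A AV; rewrite ltnS => Vk As psd AE.
  have [V0|Vne] := eqVneq V finset.set0.
    exists [::]; split=> //; rewrite big_nil; apply/matrixP => i j; rewrite [RHS]mxE.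
    by apply/eqP; apply: contraT => /AV; rewrite V0 finset.in_set0.
  have [w [wV ws]] := simplicial_exists e_sym e_irr e_ch Vne.
  have Vk' : (#|V :\ w| < k)%N.
    by move: Vk; rewrite (cardsD1 w V) wV.
  have A_sym i j : A i j = A j i by rewrite -{1}As mxE.
  (* A zero pivot has zero row and column, so [w] leaves [V] without a rank-one term. *)
  have [Aw|Aw] := eqVneq (A w w) 0.
    apply: (IH (V :\ w)) => // i j Aij; rewrite !finset.in_setD1.
    have /andP[-> ->] := AV _ _ Aij; rewrite !andbT; apply/andP; split.
      by apply: contraNneq Aij => ->; rewrite A_sym psd_diag_eq0.
    by apply: contraNneq Aij => ->; rewrite psd_diag_eq0.
  have {}Aw : 0 < A w w by rewrite lt_def Aw psd_diag_ge0.
  have Awn : A w w != 0 by rewrite gt_eqF.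
  have nbr i : A i w != 0 -> i \in V /\ (i = w \/ e w i).
    move=> Ai; have /andP[iV _] := AV _ _ Ai; split=> //.
    have [->|iw] := eqVneq i w; first by left.
    by right; apply: contraNT Ai => ewi; rewrite AE // e_sym.
  have adj i j : A i w != 0 -> A j w != 0 -> i != j -> e i j.
    move=> /nbr[iV [->|ewi]] /nbr[jV [->|ewj]] ij //.
    - by rewrite eqxx in ij.
    - by rewrite e_sym.
    - exact: ws.
  pose B := A - (A w w)^-1 *: (col w A *m (col w A)^T).
  have BE i j : B i j = A i j - (A w w)^-1 * (A i w * A j w).
    by rewrite !mxE big_ord1 !mxE.
  have [|||||L [BL Lcl]] := IH (V :\ w) B.
  - move=> i j; rewrite BE => Bij; rewrite !finset.in_setD1.
    have iw : i != w.
      apply: contraNneq Bij => ->; rewrite (A_sym w j) mulrA mulVf //.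
      by rewrite mul1r subrr.
    have jw : j != w.
      apply: contraNneq Bij => ->; rewrite mulrCA mulVf //.
      by rewrite mulr1 subrr.
    rewrite iw jw /=.
    have [/AV //|/negPn/eqP Aij] := boolP (A i j != 0).
    have [Ai|/negPn/eqP Ai] := boolP (A i w != 0); last first.
      by rewrite Aij Ai mul0r mulr0 subrr eqxx in Bij.
    have [Aj|/negPn/eqP Aj] := boolP (A j w != 0); last first.
      by rewrite Aij Aj mulr0 mulr0 subrr eqxx in Bij.
    by have [-> _] := nbr _ Ai; have [-> _] := nbr _ Aj.
  - exact: Vk'.
  - by apply/matrixP => i j; rewrite mxE !BE A_sym [A j w * _]mulrC.
  - exact: schur_psd.
  - move=> i j ij eij; rewrite BE AE // sub0r.
    have [Ai|/negPn/eqP ->] := boolP (A i w != 0); last by rewrite mul0r mulr0 oppr0.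
    have [Aj|/negPn/eqP ->] := boolP (A j w != 0); last by rewrite !mulr0 oppr0.
    by rewrite (adj i j) in eij.
  exists (Num.sqrt (A w w)^-1 *: col w A :: L); split.
    rewrite big_cons -BL linearZ /= -scalemxAl -scalemxAr scalerA -expr2 sqr_sqrtr.
      by rewrite addrC subrK.
    by rewrite invr_ge0 ltW.
  move=> u; rewrite in_cons => /orP[/eqP ->|/Lcl //].
  apply/forallP => i; apply/implyP; rewrite inE !mxE mulf_eq0 negb_or => /andP[_ Ai].
  apply/forallP => j; apply/implyP; rewrite inE !mxE mulf_eq0 negb_or => /andP[_ Aj].
  by apply/implyP; apply: adj.
by exists #|[set: 'I_m]|.+1.
Qed.

End ChordalDecomposition.

(** * Degrees of polynomials and polynomial matrices *)

Section PolynomialDegree.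
Variables (R : realType) (n : nat).
Implicit Types p q : mpolynomial R n.

Lemma pdegC (c : R) : pdeg (mpolyC n c) = 0%N.
Proof. by rewrite /pdeg mmeasureC; case: (c != 0). Qed.

Lemma pdegD p q d : (pdeg p <= d)%N -> (pdeg q <= d)%N -> (pdeg (p + q)%R <= d)%N.
Proof.
rewrite /pdeg => hp hq; have := msizeD_le p q.
by move: hp hq; lia.
Qed.

Lemma pdegM p q d d' : (pdeg p <= d)%N -> (pdeg q <= d')%N ->
  (pdeg (p * q)%R <= d + d')%N.
Proof.
rewrite /pdeg => hp hq.
have [->|p0] := eqVneq p 0; first by rewrite mul0r mmeasure0.
have [->|q0] := eqVneq q 0; first by rewrite mulr0 mmeasure0.
rewrite msizeM //; move: hp hq; move: (mmeasure mdeg p) (mmeasure mdeg q) => a b. lia.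
Qed.

Lemma pdegX p k d : (pdeg p <= d)%N -> (pdeg (p ^+ k)%R <= k * d)%N.
Proof.
move=> hp; elim: k => [|k IH]; first by rewrite expr0 -mpolyC1 pdegC.
by rewrite exprS mulSn pdegM.
Qed.

Lemma pdeg_sum (I : Type) (r : seq I) (P : pred I) (F : I -> mpolynomial R n) d :
  (forall i, P i -> (pdeg (F i) <= d)%N) -> (pdeg (\sum_(i <- r | P i) F i)%R <= d)%N.
Proof.
move=> h; apply: (big_ind (fun p => (pdeg p <= d)%N)) => //.
  by rewrite -mpolyC0 pdegC.
by move=> p q; exact: pdegD.
Qed.

Lemma pdeg_prod (I : finType) (F : I -> mpolynomial R n) d :
  (forall i, (pdeg (F i) <= d)%N) -> (pdeg (\prod_i F i)%R <= #|I| * d)%N.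
Proof.
move=> h; rewrite -big_enum cardE; elim: (enum I) => [|i r IH] /=.
  by rewrite big_nil -mpolyC1 pdegC.
by rewrite big_cons mulSn pdegM.
Qed.

Lemma pdeg_var (i : 'I_n) : pdeg (mpolyX R (mnm1 i)) = 1%N.
Proof. by rewrite /pdeg mmeasureX /= mdeg1. Qed.

Lemma pdeg_homog k p : homogeneous k p -> (pdeg p <= k)%N.
Proof.
move=> /dhomogP h; have [->|p0] := eqVneq p 0; first by rewrite /pdeg mmeasure0.
by rewrite /pdeg -mlead_deg //= (h _ (mlead_supp p0)).
Qed.

Lemma homog_pdeg k p : homogeneous k p -> p != 0 -> pdeg p = k.
Proof. by move=> /dhomogP h p0; rewrite /pdeg -mlead_deg //= (h _ (mlead_supp p0)). Qed.

Lemma mxdeg_leqP (a b d : nat) (M : 'M[mpolynomial R n]_(a, b)) :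
  reflect (forall i j, (pdeg (M i j) <= d)%N) (mxdeg M <= d)%N.
Proof.
apply: (iffP idP) => [h i j|h].
  apply: leq_trans h; apply: leq_trans (leq_bigmax i).
  exact: (leq_bigmax (F := fun j => pdeg (M i j)) j).
by apply/bigmax_leqP => i _; apply/bigmax_leqP => j _.
Qed.

End PolynomialDegree.

(** * Cones of sum-of-squares matrices *)

Section SumsOfSquares.
Variables (R : realType) (n p : nat).
Implicit Types S : 'M[mpolynomial R n]_p.

Lemma sos_mx0 : sos_mx (0 : 'M[mpolynomial R n]_p).
Proof. by exists 0%N, 0; rewrite mulmx0. Qed.

Lemma sos_mxD S S' : sos_mx S -> sos_mx S' -> sos_mx (S + S').
Proof.
move=> [r [H ->]] [r' [H' ->]]; exists (r + r')%N, (col_mx H H').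
by rewrite tr_col_mx mul_row_col.
Qed.

Lemma sos_mx_sq (f : mpolynomial R n) S : sos_mx S -> sos_mx (f ^+ 2 *: S).
Proof.
move=> [r [H ->]]; exists r, (f *: H).
have -> : (f *: H)^T = f *: H^T by apply/matrixP => i j; rewrite !mxE.
by rewrite -scalemxAl -scalemxAr scalerA expr2.
Qed.

Lemma sos_cone0 w : sos_cone w (0 : 'M[mpolynomial R n]_p).
Proof.
split; first exact: sos_mx0.
by apply/mxdeg_leqP => i j; rewrite mxE /pdeg mmeasure0.
Qed.

Lemma sos_coneD w S S' : sos_cone w S -> sos_cone w S' -> sos_cone w (S + S').
Proof.
move=> [h d] [h' d']; split; first exact: sos_mxD.
apply/mxdeg_leqP => i j; rewrite mxE; apply: pdegD.
  by move: i j; apply/mxdeg_leqP.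
by move: i j; apply/mxdeg_leqP.
Qed.

Lemma sos_cone_sq w k (f : mpolynomial R n) S :
  (pdeg f <= k)%N -> sos_cone w S -> sos_cone (w + k) (f ^+ 2 *: S).
Proof.
move=> fk [h d]; split; first exact: sos_mx_sq.
apply/mxdeg_leqP => i j; rewrite mxE addnC doubleD -!mul2n; apply: pdegM.
  exact: pdegX.
by move: i j; apply/mxdeg_leqP; rewrite mul2n.
Qed.

Lemma sos_coneW w w' S : (w <= w')%N -> sos_cone w S -> sos_cone w' S.
Proof. by move=> ww' [h d]; split=> //; apply: leq_trans d _; rewrite leq_double. Qed.

End SumsOfSquares.

Section CliqueMatrix.
Variables (A : comNzRingType) (m : nat) (C : {set 'I_m}).

(** [E^T E] is the coordinate projection onto [C], hence the identity on vectors supported there. *)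
Lemma clique_mxK (v : 'cV[A]_m) : (forall i, i \notin C -> v i 0 = 0) ->
  (clique_mx A C)^T *m (clique_mx A C *m v) = v.
Proof.
move=> vC; apply/colP => i; rewrite mxE.
have row_v k : (clique_mx A C *m v) k 0 = v (enum_val k) 0.
  rewrite mxE (bigD1 (enum_val k)) //= mxE eqxx mul1r big1 ?addr0 // => j jk.
  by rewrite mxE eq_sym (negPf jk) mul0r.
under eq_bigr => k _ do rewrite row_v !mxE.
rewrite -(big_enum_val (fun k => (k == i)%:R * v k 0)) /=.
have [iC|iC] := boolP (i \in C).
  rewrite (bigD1 i) //= eqxx mul1r big1 ?addr0 // => j /andP[_ /negPf ->].
  by rewrite mul0r.
rewrite vC // big1 // => j jC; case: eqP => [ji|_]; last by rewrite mul0r.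
by rewrite -ji jC in iC.
Qed.

End CliqueMatrix.

(** * Sums of squares split over the maximal cliques *)

Section SparseSumsOfSquares.
Variables (R : realType) (n m : nat) (e : rel 'I_m).
Implicit Types M : 'M[mpolynomial R n]_m.

Definition clique_sum (S : forall C : {set 'I_m}, 'M[mpolynomial R n]_#|C|) :
    'M[mpolynomial R n]_m :=
  \sum_(C : {set 'I_m} | maximal_clique e C)
     (clique_mx _ C)^T *m S C *m clique_mx _ C.

(** As g_j is common to all cliques, the right-hand side of the relaxation is one such matrix plus
    the sum over j of g_j times another. *)
Definition sparse_sos (w : nat) M : Prop :=
  exists2 S : forall C : {set 'I_m}, 'M[mpolynomial R n]_#|C|,
    forall C, maximal_clique e C -> sos_cone w (S C) & M = clique_sum S.

Lemma sparse_sos0 w : sparse_sos w 0.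
Proof.
exists (fun=> 0) => [C _|]; first exact: sos_cone0.
by rewrite /clique_sum big1 // => C _; rewrite mulmx0 mul0mx.
Qed.

Lemma sparse_sosD w M M' : sparse_sos w M -> sparse_sos w M' -> sparse_sos w (M + M').
Proof.
move=> [S h ->] [S' h' ->]; exists (fun C => S C + S' C) => [C Cm|].
  by apply: sos_coneD; [exact: h|exact: h'].
by rewrite /clique_sum -big_split; apply: eq_bigr => C _; rewrite mulmxDr mulmxDl.
Qed.

Lemma sparse_sos_sum w (I : Type) (r : seq I) (P : pred I)
    (F : I -> 'M[mpolynomial R n]_m) :
  (forall i, P i -> sparse_sos w (F i)) -> sparse_sos w (\sum_(i <- r | P i) F i).
Proof.
move=> h; apply: (big_ind (sparse_sos w)) => //; first exact: sparse_sos0.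
exact: sparse_sosD.
Qed.

Lemma sparse_sos_sq w k (f : mpolynomial R n) M :
  (pdeg f <= k)%N -> sparse_sos w M -> sparse_sos (w + k) (f ^+ 2 *: M).
Proof.
move=> fk [S h ->]; exists (fun C => f ^+ 2 *: S C) => [C Cm|].
  by apply: sos_cone_sq => //; exact: h.
rewrite /clique_sum scaler_sumr; apply: eq_bigr => C _.
by rewrite -scalemxAr -scalemxAl.
Qed.

Lemma sparse_sosZ w (c : R) M : 0 <= c -> sparse_sos w M ->
  sparse_sos w (mpolyC n c *: M).
Proof.
move=> c0 h; rewrite -(sqr_sqrtr c0) rmorphXn /= -[w]addn0.
by apply: sparse_sos_sq h; rewrite pdegC.
Qed.

Lemma sparse_sos_sqnorm w k M :
  sparse_sos w M -> sparse_sos (w + k) (sqnormX R n ^+ k *: M).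
Proof.
move=> h; elim: k => [|k IH]; first by rewrite addn0 expr0 scale1r.
rewrite exprS -scalerA /sqnormX scaler_suml -addn1 addnA.
by apply: sparse_sos_sum => i _; apply: sparse_sos_sq; rewrite ?pdeg_var.
Qed.

(** The whole matrix is charged to a single maximal clique containing the support of [u]. *)
Lemma sparse_sos_rank1 (u : 'cV[R]_m) : clique e [set i | u i 0 != 0] ->
  sparse_sos 0 (map_mx (@mpolyC n R) (u *m u^T)).
Proof.
move=> /(@maxset_exists _ (clique e))[C0 C0max uC0].
pose H (C : {set 'I_m}) := clique_mx R C *m u.
exists (fun C => if C == C0 then map_mx (@mpolyC n R) (H C *m (H C)^T) else 0).
  move=> C _; case: eqP => _; last exact: sos_cone0.
  split; last by apply/mxdeg_leqP => i j; rewrite mxE pdegC.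
  exists 1%N, (map_mx (@mpolyC n R) (H C)^T); by rewrite -map_trmx trmxK map_mxM map_trmx.
rewrite /clique_sum (bigD1 C0) //= eqxx big1 => [|C /andP[_ /negPf ->]]; last first.
  by rewrite mulmx0 mul0mx.
have E : clique_mx (mpolynomial R n) C0 = map_mx (@mpolyC n R) (clique_mx R C0).
  by apply/matrixP => i j; rewrite !mxE rmorph_nat.
rewrite E map_trmx -!map_mxM addr0; congr map_mx.
rewrite mulmxA -(mulmxA _ (H C0)^T) -[(H C0)^T *m _]trmxK trmx_mul trmxK clique_mxK //.
move=> i iC; apply: contraNeq iC => ui; apply: (fintype.subsetP uC0).
by rewrite inE.
Qed.

Lemma sparse_sos_psd (A : 'M[R]_m) :
  ssrbool.symmetric e -> irreflexive e -> chordal e ->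
  A^T = A -> pos_semidef A -> (forall i j, i != j -> ~~ e i j -> A i j = 0) ->
  sparse_sos 0 (map_mx (@mpolyC n R) A).
Proof.
move=> es ei ec As Ap Ae.
have [L [-> Lcl]] := chordal_psd_decomp es ei ec As Ap Ae.
rewrite raddf_sum big_seq; apply: sparse_sos_sum => u uL.
exact/sparse_sos_rank1/Lcl.
Qed.

End SparseSumsOfSquares.

(** * Forms as symmetric tensors indexed by words *)

Section HomogeneousForms.
Variables (R : realType) (N : nat).
Implicit Types F : mpolynomial R N.

Lemma meval_homog k F (c : R) (v : 'I_N -> R) : homogeneous k F ->
  meval (fun i => c * v i) F = c ^+ k * meval v F.
Proof.
move=> /dhomogP h; rewrite !mevalE mulr_sumr !big_seq; apply: eq_bigr => w wF.
rewrite mulrCA; congr (_ * _).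
under eq_bigr do rewrite exprMn.
by rewrite big_split prodrXr -(h w wF) /= mdegE.
Qed.

(** Spelling monomials as words turns the coefficients in Polya's theorem into counts of maps
    between finite sets. *)
Definition word_mnm e (u : {ffun 'I_e -> 'I_N}) : multinom N :=
  (\big[mnm_add/mnm0]_j mnm1 (u j)).

Lemma mpolyX_word e (u : {ffun 'I_e -> 'I_N}) :
  mpolyX R (word_mnm u) = \prod_j mpolyX R (mnm1 (u j)).
Proof. by rewrite mprodXE. Qed.

Lemma word_exists e (w : multinom N) : mdeg w = e ->
  exists u : {ffun 'I_e -> 'I_N}, word_mnm u = w.
Proof.
move=> we; have sz : size (m2s w) == e by rewrite size_m2s we.
exists [ffun j => tnth (Tuple sz) j]; apply/mnmP => i.
rewrite -[in RHS](s2mK w) /s2m mnmE mnm_sumE.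
under eq_bigr do rewrite ffunE mnm1E.
by rewrite -sum1_count -big_mkcond /= -[m2s w]/(tval (Tuple sz)) big_tuple.
Qed.

(* The coefficient of a monomial is shared equally among the words spelling it. *)
Definition sym_tensor e F (u : {ffun 'I_e -> 'I_N}) : R :=
  mcoeff (word_mnm u) F
    / #|[set u' : {ffun 'I_e -> 'I_N} | word_mnm u' == word_mnm u]|%:R.

Lemma sym_tensor0 e (u : {ffun 'I_e -> 'I_N}) : sym_tensor 0 u = 0.
Proof. by rewrite /sym_tensor mcoeff0 mul0r. Qed.

Lemma sym_tensorE e F : homogeneous e F ->
  F = \sum_(u : {ffun 'I_e -> 'I_N}) sym_tensor F u *: \prod_j mpolyX R (mnm1 (u j)).
Proof.
move=> Fe; apply/mpolyP => w; rewrite raddf_sum /=.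
under eq_bigr do rewrite mcoeffZ -mpolyX_word mcoeffX.
rewrite (bigID (fun u => word_mnm u == w)) /= [X in _ + X]big1 ?addr0; last first.
  by move=> u /negPf ->; rewrite mulr0.
pose K := #|[set u' : {ffun 'I_e -> 'I_N} | word_mnm u' == w]|.
rewrite (eq_bigr (fun=> mcoeff w F / K%:R)); last first.
  by move=> u /eqP uw; rewrite /sym_tensor uw eqxx mulr1.
rewrite sumr_const -[RHS]mulr_natr -mulrA.
have [Fw|Fw] := eqVneq (mcoeff w F) 0; first by rewrite Fw mul0r.
have K0 : (0 < K)%N.
  have [u uw] : exists u : {ffun 'I_e -> 'I_N}, word_mnm u = w.
    by apply: word_exists; move/dhomogP: Fe; apply; rewrite mcoeff_msupp.
  by apply/card_gt0P; exists u; rewrite inE; apply/eqP.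
rewrite (_ : #|_| = K); last first.
  by apply: eq_card => u; rewrite [RHS]inE.
by rewrite mulVf ?mulr1 // pnatr_eq0 -lt0n.
Qed.

Lemma meval_sym_tensor e F (v : 'I_N -> R) : homogeneous e F ->
  meval v F = \sum_(u : {ffun 'I_e -> 'I_N}) sym_tensor F u * \prod_j v (u j).
Proof.
move=> Fe; rewrite {1}(sym_tensorE Fe) raddf_sum /=; apply: eq_bigr => u _.
by rewrite mevalZ rmorph_prod /=; congr (_ * _); apply: eq_bigr => j _; rewrite mevalXU.
Qed.

End HomogeneousForms.

(** * Sums over subwords *)

Section WordSums.
Variables (S : comNzRingType) (N e t : nat).

Definition subword (w : {ffun 'I_t -> 'I_N}) (f : {ffun 'I_e -> 'I_t}) :
    {ffun 'I_e -> 'I_N} := [ffun j => w (f j)].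

(** An injective [f] prescribes the letters of [w] at [e] distinct positions; each of the [t - e]
    others is free and contributes a factor [\sum_i z i]. *)
Lemma sum_subword_inj (z : 'I_N -> S) (a : {ffun 'I_e -> 'I_N} -> S)
    (f : {ffun 'I_e -> 'I_t}) : injective f ->
  \sum_w a (subword w f) * \prod_k z (w k) =
  (\sum_i z i) ^+ (t - e) * \sum_u a u * \prod_j z (u j).
Proof.
move=> f_inj; rewrite (partition_big (fun w => subword w f) predT) //= mulr_sumr.
apply: eq_bigr => u _; rewrite mulrCA.
rewrite (eq_bigr (fun w : {ffun 'I_t -> 'I_N} => a u * \prod_k z (w k))); last first.
  by move=> w /eqP ->.
rewrite -mulr_sumr; congr (_ * _).
pose Q k := [pred i | [forall j, (f j == k) ==> (u j == i)]].
have -> : \sum_(w | subword w f == u) \prod_k z (w k) =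
    \sum_(w in family Q) \prod_k z (w k).
  apply: eq_bigl => w; apply/eqP/familyP => [uE k|h].
    by rewrite inE; apply/forallP => j; apply/implyP => /eqP <-; rewrite -uE ffunE.
  apply/ffunP => j; rewrite ffunE; have /forallP/(_ j) := h (f j).
  by rewrite eqxx /= => /eqP.
rewrite -(bigA_distr_big_dep Q (fun _ i => z i)).
rewrite (bigID (mem [set f j | j in 'I_e])) /= mulrC; congr (_ * _).
  rewrite (eq_bigr (fun=> \sum_i z i)) => [|k kf].
    rewrite prodr_const; congr (_ ^+ _).
    rewrite -[RHS](_ : #|~: [set f j | j in 'I_e]| = _)%N.
      by apply: eq_card => k; rewrite !inE.
    by rewrite cardsCs finset.setCK card_imset // !card_ord.
  apply: eq_bigl => i; apply/forallP => j; apply/implyP => /eqP fj.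
  by rewrite -fj imset_f in kf.
rewrite big_imset /=; last by move=> i j _ _; exact: f_inj.
apply: eq_bigr => j _; rewrite (big_pred1 (u j)) // => i.
apply/forallP/eqP => [/(_ j)|-> j']; first by rewrite eqxx /= => /eqP.
by apply/implyP => /eqP /f_inj ->.
Qed.

(** Without injectivity the positions are chosen independently, each letter of [u] having as many
    choices as it has occurrences in [w]. *)
Lemma sum_subword_all (a : {ffun 'I_e -> 'I_N} -> S) (w : {ffun 'I_t -> 'I_N}) :
  \sum_f a (subword w f) = \sum_u a u * \prod_j #|[set k | w k == u j]|%:R.
Proof.
rewrite (partition_big (fun f => subword w f) predT) //.
apply: eq_bigr => u _; rewrite (eq_bigr (fun=> a u)) => [|f /eqP -> //].
rewrite sumr_const (_ : #|_| = #|[set f | subword w f == u]|); last first.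
  by apply: eq_card => f; rewrite [RHS]inE.
rewrite -[LHS]mulr_natr; congr (_ * _); rewrite -natr_prod; congr _%:R.
transitivity #|family (fun j => [pred k | w k == u j])|.
  apply: eq_card => f; rewrite inE; apply/eqP/familyP => [fu j|h]; first by rewrite inE -fu ffunE.
  by apply/ffunP => j; rewrite ffunE; have := h j; rewrite inE => /eqP.
rewrite card_family foldrE big_map big_enum; apply: eq_bigr => j _.
by apply: eq_card => k; rewrite !inE.
Qed.

(** Cleared of denominators: at most a fraction [e ^ 2 / t] of the maps from [e] to [t] points fail
    to be injective. *)
Lemma ffact_lower : (t * t ^ e <= t * t ^_ e + e ^ 2 * t ^ e)%N.
Proof.
elim: e => [|d IH]; first by rewrite !expn0 ffactn0 leq_addr.
have dle : (t ^_ d <= t ^ d)%N.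
  elim: d {IH} => [|d IH]; first by rewrite ffactn0 expn0.
  by rewrite ffactnSr expnSr leq_mul // leq_subr.
rewrite ffactnSr expnSr; move: (t ^_ d) (t ^ d)%N IH dle => x y IH dle.
(* Only an inequality, because the subtraction truncates when [d] exceeds [t]. *)
have h : (t <= t - d + d)%N by lia.
have : (t * y * t <= (t * x + d ^ 2 * y) * t)%N by rewrite leq_mul2r IH orbT.
have : (t * x * t <= t * x * (t - d + d))%N by rewrite leq_mul2l h orbT.
have : (t * d * x <= t * d * y)%N by rewrite leq_mul2l dle orbT.
move: (t - d)%N => td; rewrite !mulnDr !mulnDl -!mulnn !mulSn !mulnS !mulnDl; nia.
Qed.

End WordSums.

(** * Polya's theorem for matrices *)

Section Polya.
Variables (R : realType) (N m e : nat) (F : 'M[mpolynomial R N]_m).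

Lemma form_sum (A : 'M[R]_m) (v : 'cV[R]_m) :
  (v^T *m A *m v) 0 0 = \sum_i \sum_j v i 0 * v j 0 * A i j.
Proof.
rewrite mxE exchange_big /=; apply: eq_bigr => j _; rewrite !mxE mulr_suml.
by apply: eq_bigr => i _; rewrite !mxE mulrAC.
Qed.

Lemma form_comb (a b : R) (A B : 'M[R]_m) (v : 'cV[R]_m) :
  (v^T *m (a *: A + b *: B) *m v) 0 0 =
  a * (v^T *m A *m v) 0 0 + b * (v^T *m B *m v) 0 0.
Proof.
rewrite !form_sum !mulr_sumr -big_split; apply: eq_bigr => i _.
rewrite !mulr_sumr -big_split; apply: eq_bigr => j _.
by rewrite !mxE /=; ring.
Qed.

Lemma form_le_sqnorm (A : 'M[R]_m) (v : 'cV[R]_m) :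
  `|(v^T *m A *m v) 0 0| <= (\sum_i \sum_j `|A i j|) * \sum_i v i 0 ^+ 2.
Proof.
rewrite form_sum; apply: le_trans (ler_norm_sum _ _ _) _; rewrite mulr_suml.
apply: ler_sum => i _; apply: le_trans (ler_norm_sum _ _ _) _; rewrite mulr_suml.
apply: ler_sum => j _; rewrite normrM mulrC ler_wpM2l //.
have sq_le k : v k 0 ^+ 2 <= \sum_i v i 0 ^+ 2.
  by rewrite (bigD1 k) //= lerDl sumr_ge0 // => ? _; rewrite sqr_ge0.
rewrite normrM; have := sq_le i; have := sq_le j.
rewrite -(real_normK (num_real (v i 0))) -(real_normK (num_real (v j 0))).
have := sqr_ge0 (`|v i 0| - `|v j 0|).
by nra.
Qed.

(* The average of the tensor over the subwords of w, i.e., over the ways to spread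
   e factors among the t factors of the monomial w. *)
Definition polya_coef t (w : {ffun 'I_t -> 'I_N}) : 'M[R]_m :=
  \matrix_(i, j) ((t ^_ e)%:R^-1 *
    \sum_(f : {ffun 'I_e -> 'I_t} | injectiveb f) sym_tensor (F i j) (subword w f)).

Hypothesis F_homog : forall i j, homogeneous e (F i j).

(** By [sum_subword_inj] every injective [f] alone already yields the left-hand side, hence so does
    their average; averaging matters for the positivity of the coefficients. *)
Lemma polya_coefE t : (e <= t)%N ->
  (\sum_i mpolyX R (mnm1 i)) ^+ (t - e) *: F =
  \sum_(w : {ffun 'I_t -> 'I_N})
     (\prod_k mpolyX R (mnm1 (w k))) *: map_mx (@mpolyC N R) (polya_coef w).
Proof.
move=> et; apply/matrixP => i j; rewrite [LHS]mxE summxE.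
under [RHS]eq_bigr do rewrite /polya_coef 3!mxE mulrC rmorphM rmorph_sum /= -mulrA mulr_suml.
rewrite -mulr_sumr exchange_big /=.
pose a (u : {ffun 'I_e -> 'I_N}) := mpolyC N (sym_tensor (F i j) u) : mpolynomial R N.
rewrite [X in _ = _ * X](eq_bigr (fun=> (\sum_i mpolyX R (mnm1 i)) ^+ (t - e) * F i j)); last first.
  move=> f /injectiveP f_inj; apply: eq_trans (sum_subword_inj (fun k => mpolyX R (mnm1 k)) a f_inj) _.
  congr (_ * _).
  rewrite [RHS](sym_tensorE (F_homog i j)); apply: eq_bigr => u _.
  by rewrite mul_mpolyC.
rewrite sumr_const mulrnAr -mulrnAl -raddfMn /= -[_^-1 *+ _]mulr_natr.
rewrite (_ : #|_| = (t ^_ e)%N); last first.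
  by rewrite -[in RHS](card_ord t) -[in RHS](card_ord e) -card_inj_ffuns cardsE.
by rewrite mulVf ?mpolyC1 ?mul1r // pnatr_eq0 -lt0n ffact_gt0.
Qed.

Lemma polya_coef_form t (w : {ffun 'I_t -> 'I_N}) (v : 'cV[R]_m) :
  (t ^_ e)%:R * (v^T *m polya_coef w *m v) 0 0 =
  \sum_(f : {ffun 'I_e -> 'I_t} | injectiveb f)
     (v^T *m (\matrix_(i, j) sym_tensor (F i j) (subword w f)) *m v) 0 0.
Proof.
under [RHS]eq_bigr do rewrite form_sum.
rewrite form_sum mulr_sumr exchange_big; apply: eq_bigr => i _.
rewrite mulr_sumr exchange_big; apply: eq_bigr => j _.
rewrite mxE mulrCA.
under [RHS]eq_bigr do rewrite mxE.
rewrite -mulr_sumr; congr (_ * _).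
have [ff|ff] := eqVneq (t ^_ e)%N 0%N; last first.
  by rewrite mulrA mulfV ?mul1r // pnatr_eq0.
rewrite ff mul0r big_pred0 // => f; apply/negP => finj.
have := card_inj_ffuns ('I_e : finType) ('I_t : finType).
rewrite !card_ord ff => /eqP; rewrite cards_eq0 => /eqP/setP/(_ f).
by rewrite !inE finj.
Qed.

(* Averaging over all f instead of the injective ones would give the value of F
   at the letter frequencies of w; the non-injective f are an O(1 / t) fraction. *)
Lemma polya_coef_psd (c : R) : 0 < c ->
  (forall z : 'rV[R]_N, (forall i, 0 <= z 0 i) -> \sum_i z 0 i = 1 ->
     forall v : 'cV[R]_m, c * \sum_i v i 0 ^+ 2 <= (v^T *m mxeval F z *m v) 0 0) ->
  exists t0, forall t (w : {ffun 'I_t -> 'I_N}), (t0 <= t)%N ->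
    pos_semidef (polya_coef w).
Proof.
move=> c0 Fc.
pose K := \sum_(u : {ffun 'I_e -> 'I_N}) \sum_i \sum_j `|sym_tensor (F i j) u|.
have K0 : 0 <= K by do 3 (apply: sumr_ge0 => ? _).
(* The sum over all maps is at least [c * t ^ e] times the squared norm of [v]; the noninjective
   ones take away at most [K * (e ^ 2 / t) * t ^ e] times it. So [c * t >= e ^ 2 * K] suffices, and
   [e <= t] provides injective maps. *)
exists (maxn e (Num.truncn ((e ^ 2)%:R * K / c)).+1) => t w.
rewrite geq_max => /andP[et tK] v.
have t0 : 0 < t%:R :> R by rewrite ltr0n; apply: leq_ltn_trans tK.
have Kt : (e ^ 2)%:R * K <= c * t%:R.
  rewrite [c * _]mulrC -ler_pdivrMr //; apply/ltW/(lt_le_trans (truncnS_gt _)).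
  by rewrite ler_nat.
have ff0 : 0 < (t ^_ e)%:R :> R by rewrite ltr0n ffact_gt0.
rewrite -(pmulr_rge0 _ ff0) polya_coef_form.
set nv := \sum_i v i 0 ^+ 2 in Fc *.
have nv0 : 0 <= nv by apply: sumr_ge0 => i _; rewrite sqr_ge0.
pose a (u : {ffun 'I_e -> 'I_N}) := (v^T *m (\matrix_(i, j) sym_tensor (F i j) u) *m v) 0 0.
have aK u : `|a u| <= K * nv.
  apply: le_trans (form_le_sqnorm _ _) _; rewrite ler_wpM2r //.
  rewrite /K (bigD1 u) //= -[leLHS]addr0 lerD //.
    by apply: ler_sum => i _; apply: ler_sum => j _; rewrite mxE.
  by do 3 (apply: sumr_ge0 => ? _).
have all_ge : c * nv * (t ^ e)%:R <= \sum_(f : {ffun 'I_e -> 'I_t}) a (subword w f).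
  pose z : 'rV[R]_N := \row_i (#|[set k | w k == i]|%:R / t%:R).
  have z0 i : 0 <= z 0 i by rewrite mxE divr_ge0.
  have z1 : \sum_i z 0 i = 1.
    under eq_bigr do rewrite mxE.
    rewrite -mulr_suml -natr_sum; under eq_bigr do rewrite -sum1dep_card.
    rewrite (exchange_big_dep predT) //=.
    rewrite [X in X%:R](eq_bigr (fun=> 1%N)) => [|k _].
      by rewrite sum1_card card_ord mulfV // gt_eqF.
    by rewrite (big_pred1 (w k)) // => i; rewrite /= eq_sym.
  have := Fc z z0 z1 v; rewrite sum_subword_all => h.
  have te0 : 0 < (t ^ e)%:R :> R by rewrite natrX exprn_gt0.
  suff -> : \sum_u a u * \prod_j #|[set k | w k == u j]|%:R =
      (v^T *m mxeval F z *m v) 0 0 * (t ^ e)%:R by rewrite ler_wpM2r // ltW.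
  rewrite form_sum; under eq_bigr do rewrite /a form_sum mulr_suml.
  rewrite exchange_big mulr_suml; apply: eq_bigr => i _.
  under eq_bigr do rewrite mulr_suml.
  rewrite exchange_big mulr_suml; apply: eq_bigr => j _.
  rewrite -mulrA mxE.
  under eq_bigr do rewrite mxE -mulrA.
  rewrite -mulr_sumr; congr (_ * _).
  rewrite -(meval_sym_tensor (fun k => #|[set k' | w k' == k]|%:R) (F_homog i j)).
  rewrite mulrC natrX -meval_homog //; apply: meval_eq => k.
  by rewrite mxE mulrCA mulfV ?mulr1 // gt_eqF.
have bad : #|[set f : {ffun 'I_e -> 'I_t} | ~~ injectiveb f]|%:R =
    (t ^ e)%:R - (t ^_ e)%:R :> R.
  apply/eqP; rewrite eq_sym subr_eq -natrD eqr_nat.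
  have := cardC [pred f : {ffun 'I_e -> 'I_t} | injectiveb f].
  rewrite card_ffun !card_ord => <-.
  have := card_inj_ffuns ('I_e : finType) ('I_t : finType).
  rewrite !card_ord => <-; rewrite addnC; apply/eqP; congr (_ + _)%N.
    by apply: eq_card => f; rewrite !inE.
  by apply: eq_card => f; rewrite !inE.
have bad_le : \sum_(f : {ffun 'I_e -> 'I_t} | ~~ injectiveb f) a (subword w f) <=
    ((t ^ e)%:R - (t ^_ e)%:R) * (K * nv).
  rewrite -bad mulr_natl -sumr_const.
  rewrite [leRHS](eq_bigl (fun f : {ffun 'I_e -> 'I_t} => ~~ injectiveb f)).
    by apply: ler_sum => f _; apply: le_trans (ler_norm _) (aK _).
  by move=> f; rewrite inE.
rewrite -[leRHS]/(\sum_(f : {ffun 'I_e -> 'I_t} | injectiveb f) a (subword w f)).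
rewrite (bigID (fun f : {ffun 'I_e -> 'I_t} => injectiveb f)) /= in all_ge.
rewrite -[leRHS](addrK (\sum_(f : {ffun 'I_e -> 'I_t} | ~~ injectiveb f) a (subword w f))).
rewrite subr_ge0; apply: le_trans bad_le (le_trans _ all_ge).
rewrite -(ler_pM2l t0).
have : t%:R * (t ^ e)%:R <= t%:R * (t ^_ e)%:R + (e ^ 2)%:R * (t ^ e)%:R :> R.
  by rewrite -!natrM -natrD ler_nat ffact_lower.
have te0 : 0 <= (t ^ e)%:R :> R by [].
move: te0 Kt; move: (t ^ e)%:R (t ^_ e)%:R (e ^ 2)%:R => x y d x0 Kt h.
have h1 : (t%:R * (x - y)) * (K * nv) <= (d * x) * (K * nv).
  by rewrite ler_wpM2r ?mulr_ge0 // mulrBr lerBlDl.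
have h2 : (d * K) * (x * nv) <= (c * t%:R) * (x * nv) by rewrite ler_wpM2r // mulr_ge0.
rewrite mulrA; apply: le_trans h1 _.
have -> : d * x * (K * nv) = d * K * (x * nv) by ring.
by have -> : t%:R * (c * nv * x) = c * t%:R * (x * nv) by ring.
Qed.

End Polya.

Local Open Scope classical_set_scope.

(** * Penalties on compact sets *)

Section Penalty.
Variables (R : realType) (T : topologicalType).

Lemma continuous_sum (I : Type) (r : seq I) (F : I -> T -> R) :
  (forall i, continuous (F i)) -> continuous (fun x => \sum_(i <- r) F i x).
Proof. by move=> Fc; apply: continuous_big => //; exact: add_continuous. Qed.

Lemma continuous_prod (I : Type) (r : seq I) (F : I -> T -> R) :
  (forall i, continuous (F i)) -> continuous (fun x => \prod_(i <- r) F i x).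
Proof. by move=> Fc; apply: continuous_big => //; exact: mul_continuous. Qed.

Lemma compact_lower_bound (D : set T) (f : T -> R) : compact D -> continuous f ->
  (forall t, D t -> 0 < f t) -> exists2 c, 0 < c & forall t, D t -> c <= f t.
Proof.
move=> cD fc fpos; have [[t0 Dt0]|D0] := pselect (D !=set0); last first.
  by exists 1 => // t Dt; case: D0; exists t.
have [|c Dc cmin] := compact_EVT_min (ex_intro _ t0 Dt0) cD (f := f).
  exact: continuous_subspaceT.
exists (f c) => [|t Dt]; first by apply: fpos; rewrite inE in Dc.
by apply: cmin; rewrite inE.
Qed.

Lemma compact_upper_bound (D : set T) (f : T -> R) : compact D -> continuous f ->
  exists c, forall t, D t -> f t <= c.
Proof.
move=> cD fc; have [[t0 Dt0]|D0] := pselect (D !=set0); last first.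
  by exists 1 => // t Dt; case: D0; exists t.
have [|c Dc cmax] := compact_EVT_max (ex_intro _ t0 Dt0) cD (f := f).
  exact: continuous_subspaceT.
by exists (f c) => t Dt; apply: cmax; rewrite inE.
Qed.

Lemma peak_bound (k : nat) (u : R) : 0 <= u <= 1 -> k%:R * (u * (1 - u) ^+ k) <= 1.
Proof.
move=> /andP[u0 u1]; set a := 1 - u.
have a0 : 0 <= a by rewrite subr_ge0.
have a1 : a <= 1 by rewrite gerBl.
(* The stronger bound [(1 + k u) (1 - u)^k <= 1] is the one that passes through the induction. *)
suff : k%:R * (u * a ^+ k) + a ^+ k <= 1.
  by apply: le_trans; rewrite lerDl exprn_ge0.
elim: k => [|k IH]; first by rewrite mul0r expr0 add0r.
have ak : a ^+ k <= 1 by apply: exprn_ile1.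
have ak0 : 0 <= a ^+ k by apply: exprn_ge0.
rewrite exprS -natr1; move: IH ak ak0; move: (a ^+ k) (k%:R : R) => x y IH x1 x0.
have h1 : a * (y * (u * x) + x) <= a * 1 by rewrite ler_wpM2l.
have h2 : u * (a * x) <= u * 1.
  by rewrite ler_wpM2l // mulr_ile1.
have -> : (y + 1) * (u * (a * x)) + a * x = a * (y * (u * x) + x) + u * (a * x).
  by ring.
apply: le_trans (lerD h1 h2) _; rewrite !mulr1 /a.
by rewrite subrK.
Qed.

(* A constraint violated by eta contributes at least c * eta, whatever k is,
   while by peak_bound the satisfied ones contribute O(c / k) each. *)
Lemma penalty_normalized (D : set T) (J : finType) (f : T -> R) (h : J -> T -> R) :
  compact D -> continuous f -> (forall j, continuous (h j)) ->
  (forall j t, D t -> `|h j t| <= 1) ->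
  (forall t, D t -> (forall j, 0 <= h j t) -> 0 < f t) ->
  exists c k c0, [/\ 0 <= c, 0 < c0 &
    forall t, D t -> c0 <= f t - c * \sum_j h j t * (1 - h j t) ^+ k.*2].
Proof.
move=> cD fc hc h1 fpos.
(* Twice the positive part of [f] plus twice the total violation. It is positive on [D], and its
   lower bound [mu] says that [f] is bounded below by a positive constant wherever the violations
   are small. *)
pose g t := `|f t| + f t + \sum_j (`|h j t| - h j t).
have gc : continuous g.
  move=> t; apply: cvgD; first apply: cvgD.
  - by apply: cvg_norm; exact: fc.
  - exact: fc.
  - apply: continuous_sum => j {}t; apply: cvgB; last exact: hc.
    by apply: cvg_norm; exact: hc.
have gpos t : D t -> 0 < g t.
  move=> Dt; have s0 : 0 <= \sum_j (`|h j t| - h j t).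
    by apply: sumr_ge0 => j _; rewrite subr_ge0 ler_norm.
  have f0 : 0 <= `|f t| + f t by have := ler_norm (- f t); rewrite normrN; lra.
  rewrite lt_def addr_ge0 // andbT paddr_eq0 //; apply/negP => /andP[/eqP fE sE].
  have : 0 < f t.
    apply: fpos => // j; move: sE; rewrite psumr_eq0; last first.
      by move=> i _; rewrite subr_ge0 ler_norm.
    by move=> /allP/(_ j (mem_index_enum _)); rewrite subr_eq0 => /eqP <-.
  move=> ft; rewrite gtr0_norm // in fE.
  by move: ft; lra.
have [mu mu0 gmu] := compact_lower_bound cD gc gpos.
have [Fb fFb] := compact_upper_bound cD (f := fun t => - f t) (fun t => continuousN (fc t)).
pose q : R := #|J|%:R.
have q0 : 0 <= q by rewrite ler0n.
(* Violations of at most [eta] each use up at most half of [mu], which leaves [f >= mu / 4]. *)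
pose eta := mu / (4 * (q + 1)).
have eta0 : 0 < eta by rewrite divr_gt0 // mulr_gt0 // ltr_wpDl.
have qeta : 2 * q * eta <= mu / 2.
  have : 4 * (q + 1) * eta = mu by rewrite /eta mulrC divfK // gt_eqF // mulr_gt0 // ltr_wpDl.
  by nra.
(* Half of [c * eta] outweighs the lower bound [- Fb] of [f] by at least 1; the other half absorbs
   the satisfied constraints. *)
pose c := 2 * (`|Fb| + 1) / eta.
have c0 : 0 < c by rewrite divr_gt0 // mulr_gt0 // ltr_wpDl.
have A8 : 0 <= 8 * c * q / mu by rewrite !mulr_ge0 ?invr_ge0 // ltW.
have [[eta_ge mu_ge] c_ge] := (ltW eta0, ltW mu0, ltW c0).
(* The two terms make the total [d] of the satisfied constraints at most [eta / 2], and [c * d] at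
   most [mu / 8]. *)
pose A := q / eta + 8 * c * q / mu.
pose k := (Num.truncn A).+1.
have Ak : A <= k%:R by apply/ltW/truncnS_gt.
have k0 : 0 < (k%:R : R) by rewrite ltr0n.
pose d := q / k.*2%:R.
have k20 : 0 < k.*2%:R :> R by rewrite ltr0n double_gt0.
have dk : d * k.*2%:R = q by rewrite /d divfK // gt_eqF.
have k2E : k.*2%:R = 2 * k%:R :> R by rewrite -mul2n natrM.
have deta : d <= eta / 2.
  rewrite /d ler_pdivrMr // k2E mulrA divfK // mulrC -ler_pdivrMr //.
  by apply: le_trans Ak; rewrite /A lerDl.
have dmu : c * d <= mu / 8.
  rewrite /d mulrA ler_pdivrMr // k2E.
  have : 8 * c * q / mu <= k%:R by apply: le_trans Ak; rewrite /A lerDr divr_ge0.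
  rewrite ler_pdivrMr // => H; have := mulr_gt0 mu0 k0; by nra.
have term_le j t : D t -> h j t * (1 - h j t) ^+ k.*2 <= k.*2%:R^-1.
  move=> Dt; have [hj|hj] := leP 0 (h j t); last first.
    apply: le_trans (_ : 0 <= _); last by rewrite invr_ge0.
    by rewrite mulr_le0_ge0 ?exprn_ge0 // ltW // subr_gt0 (lt_trans hj).
  rewrite -[leRHS]mul1r ler_pdivlMr // mulrC; apply: peak_bound.
  by rewrite hj /= (le_trans (ler_norm _)) // h1.
exists c, k, (Num.min (mu / 8) 1); split; [exact: ltW|by rewrite lt_min divr_gt0 /=|].
move=> t Dt; rewrite ge_min; apply/orP.
have [/existsP[j hj]|hall] := boolP [exists j, h j t < - eta]; [right|left].
  have hsum : \sum_i h i t * (1 - h i t) ^+ k.*2 <= - eta + d.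
    rewrite (bigD1 j) //= lerD //.
      have h0 : h j t <= 0 by apply: le_trans (ltW hj) _; rewrite oppr_le0 ltW.
      apply: le_trans (ltW hj); rewrite -[leRHS]mulr1 ler_wnM2l // exprn_ege1 //.
      by rewrite lerBrDr gerDl.
    apply: le_trans (ler_sum _ (fun i _ => term_le i t Dt)) _.
    rewrite sumr_const -[leLHS]mulr_natl /d ler_wpM2r ?invr_ge0 // ler_nat.
    exact: max_card.
  have := fFb t Dt; have := ler_norm Fb.
  have cE : c * eta = 2 * (`|Fb| + 1) by rewrite /c divfK // gt_eqF.
  have : c * (\sum_i h i t * (1 - h i t) ^+ k.*2) <= c * (- eta + d).
    by rewrite ler_wpM2l // ltW.
  have : c * d <= c * (eta / 2) by rewrite ler_wpM2l // ltW.
  by move: cE; move: (\sum_i _) => s; nra.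
have {}hall j : - eta <= h j t.
  by rewrite leNgt; apply: contra hall => hj; apply/existsP; exists j.
have hsum : \sum_i h i t * (1 - h i t) ^+ k.*2 <= d.
  apply: le_trans (ler_sum _ (fun i _ => term_le i t Dt)) _.
  by rewrite sumr_const -[leLHS]mulr_natl.
have viol : \sum_j (`|h j t| - h j t) <= 2 * q * eta.
  apply: le_trans (_ : \sum_(j in J) 2 * eta <= _).
    apply: ler_sum => j _; have := hall j; case: (ger0P (h j t)) => hj.
      by rewrite subrr mulr_ge0 // ltW.
    by move: (h j t) => x; lra.
  by rewrite sumr_const -[leLHS]mulr_natl mulrCA mulrA.
have fmu : mu / 4 <= f t.
  have := gmu t Dt; rewrite /g; have [ft|ft] := ger0P (f t).
    by move: viol qeta; move: (\sum_j _) => s; lra.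
  by move: viol qeta; move: (\sum_j _) => s; lra.
have : c * (\sum_i h i t * (1 - h i t) ^+ k.*2) <= c * d by rewrite ler_wpM2l // ltW.
by move: dmu fmu; move: (c * d) (c * _) => x y; lra.
Qed.

(** The normalized case applies to [h j / M], where [M] bounds all [h j] on [D]; the [k.*2.+1]
    factors [M^-1] go into the constant. *)
Lemma penalty (D : set T) (J : finType) (f : T -> R) (h : J -> T -> R) :
  compact D -> continuous f -> (forall j, continuous (h j)) ->
  (forall t, D t -> (forall j, 0 <= h j t) -> 0 < f t) ->
  exists c M k c0, [/\ 0 <= c, 0 < c0 &
    forall t, D t -> c0 <= f t - c * \sum_j h j t * (M - h j t) ^+ k.*2].
Proof.
move=> cD fc hc fpos.
have normc j : continuous (fun t => `|h j t|).
  by move=> t; apply: cvg_norm; exact: hc.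
have [B hB] := compact_upper_bound cD (continuous_sum (r := index_enum J) normc).
pose M := `|B| + 1.
have M0 : 0 < M by rewrite ltr_wpDl.
have hM j t : D t -> `|h j t| <= M.
  move=> Dt; apply: le_trans (_ : B <= _); last by rewrite (le_trans (ler_norm _)) // lerDl.
  by apply: le_trans (hB t Dt); rewrite (bigD1 j) //= lerDl sumr_ge0.
have [|||c [k [c0 [cge0 c00 H]]]] :=
    penalty_normalized (f := f) (h := fun j t => h j t * M^-1) cD fc.
- by move=> j t; apply: cvgM; [exact: hc|exact: cvg_cst].
- by move=> j t Dt; rewrite normrM normfV (gtr0_norm M0) ler_pdivrMr // mul1r hM.
- move=> t Dt hpos; apply: fpos => // j.
  by have := hpos j; rewrite pmulr_lge0 // invr_gt0.
exists (c / M ^+ k.*2.+1), M, k, c0; split => //.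
  by rewrite divr_ge0 // exprn_ge0 // ltW.
move=> t Dt; apply: le_trans (H t Dt) _; rewrite lerB // -mulrA ler_wpM2l //.
rewrite mulr_sumr ler_sum // => j _.
rewrite [leRHS](_ : _ = (M ^+ k.*2.+1)^-1 * (h j t * (M - h j t) ^+ k.*2)) //.
have -> : 1 - h j t / M = (M - h j t) / M by field; rewrite gt_eqF.
by rewrite exprS invfM expr_div_n; ring.
Qed.

End Penalty.

(** * Linearization of even forms by squares of linear forms *)

Section Veronese.
Variables (R : realType) (n : nat).

Notation index := ('I_n * 'I_n * bool)%type.
Notation N := #|{: index}|.
Notation X i := (mpolyX R (mnm1 i)).

Definition zsq (a : index) : mpolynomial R n :=
  mpolyC n (4 * n%:R)^-1 * (X a.1.1 + (-1) ^+ a.2 * X a.1.2) ^+ 2.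

Definition veronese : mpolynomial R N -> mpolynomial R n :=
  mmap (@mpolyC n R) (fun k => zsq (enum_val k)).

HB.instance Definition _ := GRing.RMorphism.on veronese.

Notation Z a := (X (enum_rank (a : index)) : mpolynomial R N).

(** Polarization: the linear form in z whose value at z(x) is x_i x_j. *)
Definition zquad (i j : 'I_n) : mpolynomial R N :=
  locked (mpolyC N n%:R * (Z (i, j, false) - Z (i, j, true))).

(** Write y_ij for [zquad i j]. The relations [inl] recover z from y; the relations [inr] are the 2
    x 2 minors through a diagonal entry y_kk, which force y to have rank one as soon as some y_kk is
    positive. *)
Definition zrel (r : index + 'I_n * 'I_n * 'I_n) : mpolynomial R N :=
  match r with
  | inl a => mpolyC N (4 * n%:R) * Z a - (zquad a.1.1 a.1.1 + zquad a.1.2 a.1.2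
               + 2 * (-1) ^+ a.2 * zquad a.1.1 a.1.2)
  | inr (k, i, j) => zquad k k * zquad i j - zquad k i * zquad k j
  end.

(** The letters of a monomial are paired in the order in which they come; any pairing gives the same
    polynomial after substituting z(x). The value 1 on a single letter is a default, words of even
    length being the ones that matter. *)
Fixpoint lift_word (s : seq 'I_n) : mpolynomial R N :=
  match s with
  | i :: j :: s' => zquad i j * lift_word s'
  | _ => 1
  end.

Definition lift_form (p : mpolynomial R n) : mpolynomial R N :=
  \sum_(w <- msupp p) mcoeff w p *: lift_word (m2s w).

Lemma sum_index (A : nmodType) (F : index -> A) :
  \sum_(k < N) F (enum_val k) = \sum_i \sum_j (F (i, j, true) + F (i, j, false)).
Proof.
rewrite (reindex_onto (@enum_rank _) (@enum_val _ _)) /=; last first.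
  by move=> k _; rewrite enum_valK.
rewrite (eq_big predT (fun a => F (a.1.1, a.1.2, a.2))) => [||[[i j] b] _].
- rewrite -(pair_bigA _ (fun ij b => F (ij.1, ij.2, b))) /=.
  rewrite -(pair_bigA _ (fun i j => \sum_b F (i, j, b))) /=.
  by apply: eq_bigr => i _; apply: eq_bigr => j _; rewrite big_bool.
- by move=> a; rewrite enum_rankK eqxx.
- by rewrite enum_rankK.
Qed.

Lemma veroneseZ a : veronese (Z a) = zsq a.
Proof. by rewrite /veronese mmapX mmap1U enum_rankK. Qed.

Lemma veroneseC c : veronese (mpolyC N c) = mpolyC n c.
Proof. exact: mmapC. Qed.

Lemma veronese_scale c F : veronese (c *: F) = c *: veronese F.
Proof. by rewrite -mul_mpolyC rmorphM /= veroneseC mul_mpolyC. Qed.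

Lemma meval_veronese (x : 'rV[R]_n) (F : mpolynomial R N) :
  peval (veronese F) x = meval (fun k => peval (zsq (enum_val k)) x) F.
Proof.
rewrite /peval /veronese /mmap raddf_sum mevalE /=; apply: eq_bigr => w _.
rewrite rmorphM /= mevalC rmorph_prod /=; congr (_ * _).
by apply: eq_bigr => k _; rewrite rmorphXn.
Qed.

Lemma lift_form0 : lift_form 0 = 0.
Proof. by rewrite /lift_form msupp0 big_nil. Qed.

Lemma homog_Z a : homogeneous 1 (Z a).
Proof. by rewrite /homogeneous dhomogX /= mdeg1. Qed.

Lemma homogM (n' k k' : nat) (p p' : mpolynomial R n') :
  homogeneous k p -> homogeneous k' p' -> homogeneous (k + k') (p * p').
Proof. exact: dhomogM. Qed.

Lemma homogX (n' k j : nat) (p : mpolynomial R n') :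
  homogeneous k p -> homogeneous (k * j) (p ^+ j).
Proof. exact: dhomogMn. Qed.

Lemma homogCM (n' k : nat) c (p : mpolynomial R n') :
  homogeneous k p -> homogeneous k (mpolyC n' c * p).
Proof. by move=> h; rewrite mul_mpolyC; exact: dhomogZ. Qed.

Lemma homog_signM (n' k b : nat) (p : mpolynomial R n') :
  homogeneous k p -> homogeneous k ((-1) ^+ b * p).
Proof. by move=> h; rewrite -signr_odd mulr_sign; case: ifP => _ //; rewrite /homogeneous rpredN. Qed.

Lemma homog_sqnorm : homogeneous 2 (sqnormX R n).
Proof.
by apply: rpred_sum => i _; apply: (homogX (k := 1)); rewrite /homogeneous dhomogX /= mdeg1.
Qed.

Lemma homog_zquad i j : homogeneous 1 (zquad i j).
Proof. by rewrite /zquad -lock; apply: homogCM; apply: rpredB; exact: homog_Z. Qed.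

Definition zrel_deg (r : index + 'I_n * 'I_n * 'I_n) : nat :=
  if r is inl _ then 1 else 2.

Lemma homog_zrel r : homogeneous (zrel_deg r) (zrel r).
Proof.
case: r => [[[i j] b]|[[k i] j]] /=.
  apply: rpredB; first exact/homogCM/homog_Z.
  apply: rpredD; first by apply: rpredD; exact: homog_zquad.
  by rewrite -mulrA mulr_natl; apply: rpredMn; apply: homog_signM; exact: homog_zquad.
by apply: rpredB; apply: (homogM (k := 1) (k' := 1)); exact: homog_zquad.
Qed.

Hypothesis n_gt0 : (0 < n)%N.

Lemma n_neq0 : n%:R != 0 :> R.
Proof. by rewrite pnatr_eq0 -lt0n. Qed.

Lemma veronese_zquad i j : veronese (zquad i j) = X i * X j.
Proof.
rewrite /zquad -lock rmorphM rmorphB /= veroneseC !veroneseZ /zsq /= expr0 expr1 mul1r mulN1r.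
rewrite -mulrBr mulrA -mpolyCM.
have -> : n%:R * (4 * n%:R)^-1 = 4^-1 :> R by field; exact: n_neq0.
transitivity (mpolyC n 4^-1 * mpolyC n 4 * (X i * X j)).
  by rewrite -mulrA; congr (_ * _); rewrite mpolyC_nat; ring.
by rewrite -mpolyCM mulVf ?mpolyC1 ?mul1r // pnatr_eq0.
Qed.

Lemma veronese_zrel r : veronese (zrel r) = 0.
Proof.
case: r => [[[i j] b]|[[k i] j]] /=; last first.
  by rewrite rmorphB !rmorphM /= !veronese_zquad; ring.
rewrite rmorphB rmorphM /= veroneseC veroneseZ /zsq /= mulrA -mpolyCM mulfV ?mpolyC1; last first.
  by rewrite mulf_neq0 ?n_neq0 // pnatr_eq0.
rewrite !rmorphD !rmorphM /= rmorph_sign rmorph_nat !veronese_zquad.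
have sq : ((-1) ^+ b : mpolynomial R n) ^+ 2 = 1 by rewrite sqrr_sign.
by move: sq; move: ((-1) ^+ b) => s sq; rewrite sqrrD exprMn sq; ring.
Qed.

Lemma veronese_sum : veronese (\sum_k X k) = sqnormX R n.
Proof.
rewrite raddf_sum /= (eq_bigr (fun k => zsq (enum_val k))) => [|k _]; last first.
  by rewrite /veronese mmapX mmap1U.
rewrite sum_index.
rewrite (eq_bigr (fun i => \sum_j mpolyC n (2 * n%:R : R)^-1 * (X i ^+ 2 + X j ^+ 2))); last first.
  move=> i _; apply: eq_bigr => j _; rewrite /zsq /= expr0 expr1 -mulrDr.
  have -> : mpolyC n (2 * n%:R : R)^-1 = mpolyC n (4 * n%:R : R)^-1 * 2.
    rewrite [RHS]mulr_natr -raddfMn /=; apply: (congr1 (@mpolyC n R)).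
    by field; exact: n_neq0.
  by rewrite -mulrA; congr (_ * _); ring.
rewrite (eq_bigr (fun i => mpolyC n (2 * n%:R : R)^-1 * (X i ^+ 2 *+ n + sqnormX R n))); last first.
  by move=> i _; rewrite -mulr_sumr big_split /= sumr_const card_ord.
rewrite -mulr_sumr; set c := mpolyC n _.
rewrite big_split /= sumr_const card_ord sumrMnl -/(sqnormX R n) -mulr2n -mulrnA.
rewrite mulrnAr -mulrnAl; suff -> : c *+ (n * 2) = 1 by rewrite mul1r.
rewrite /c -raddfMn -(mpolyC1 n R); apply: (congr1 (@mpolyC n R)).
by rewrite -[LHS]mulr_natr natrM; field; exact: n_neq0.
Qed.

Lemma homog_lift_word k s : size s = k.*2 -> homogeneous k (lift_word s).
Proof.
elim: k s => [|k IH] [|i [|j s]] //=; first by move=> _; exact: dhomog1.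
by move=> [sz]; apply: (homogM (k := 1)); [exact: homog_zquad|exact: IH].
Qed.

Lemma veronese_lift_word k s : size s = k.*2 ->
  veronese (lift_word s) = \prod_(i <- s) X i.
Proof.
elim: k s => [|k IH] [|i [|j s]] //=; first by rewrite big_nil rmorph1.
by move=> [sz]; rewrite rmorphM /= IH // !big_cons veronese_zquad mulrA.
Qed.

Lemma homog_lift k p : homogeneous k.*2 p -> homogeneous k (lift_form p).
Proof.
move=> /dhomogP h; rewrite /lift_form big_seq; apply: rpred_sum => w wp.
by apply: rpredZ; apply: homog_lift_word; rewrite size_m2s -(h w wp).
Qed.

Lemma veronese_lift k p : homogeneous k.*2 p -> veronese (lift_form p) = p.
Proof.
move=> /dhomogP h; rewrite /lift_form raddf_sum /= [RHS]mpolyE !big_seq.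
apply: eq_bigr => w wp; rewrite veronese_scale; congr (_ *: _).
rewrite (@veronese_lift_word k) ?size_m2s -?(h w wp) //.
rewrite -[in RHS](s2mK w) mprodXE; congr mpolyX; apply/mnmP => i.
rewrite mnm_sumE /s2m mnmE -sum1_count [RHS]big_mkcond /=.
by apply: eq_bigr => j _; rewrite mnm1E; case: eqP.
Qed.

(** Nonnegativity of z makes the diagonal of y nonnegative, and its sum 1 makes the trace of y equal
    to 1. So some y_kk is positive, and the minors give y = x^T x for x the k-th row of y divided by
    the square root of y_kk. *)
Lemma veronese_pt (z : 'I_N -> R) :
  (forall k, 0 <= z k) -> \sum_k z k = 1 -> (forall r, meval z (zrel r) = 0) ->
  exists x : 'rV[R]_n, \sum_i x 0 i ^+ 2 = 1 /\
    forall k, z k = peval (zsq (enum_val k)) x.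
Proof.
move=> z0 z1 zr; pose y i j := meval z (zquad i j).
have zy a : z (enum_rank a) = (4 * n%:R)^-1 *
    (y a.1.1 a.1.1 + y a.1.2 a.1.2 + 2 * (-1) ^+ a.2 * y a.1.1 a.1.2).
  have := zr (inl a); rewrite /= rmorphB !rmorphD !rmorphM /= !mevalC mevalXU.
  rewrite rmorph_sign (rmorph_nat (meval z) 2) -!/(y _ _) => /eqP; rewrite subr_eq0 => /eqP <-.
  by rewrite mulKf // mulf_neq0 ?n_neq0 // pnatr_eq0.
have yy k i j : y k k * y i j = y k i * y k j.
  have := zr (inr (k, i, j)); rewrite /= rmorphB !rmorphM /= -!/(y _ _).
  by move/eqP; rewrite subr_eq0 => /eqP.
have yii i : 0 <= y i i.
  have := zy (i, i, false); rewrite /= expr0 mulr1 => E.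
  have := z0 (enum_rank (i, i, false)); rewrite E pmulr_rge0; last first.
    by rewrite invr_gt0 mulr_gt0 // ltr0n.
  by move: (y i i) => u; lra.
have sy : \sum_i y i i = 1.
  apply/esym; rewrite -z1 -(eq_bigr _ (fun k _ => congr1 z (enum_valK k))).
  rewrite (sum_index (fun a => z (enum_rank a))).
  rewrite (eq_bigr (fun i => \sum_j (2 * n%:R)^-1 * (y i i + y j j))); last first.
    move=> i _; apply: eq_bigr => j _; rewrite !zy /= expr0 expr1.
    by field; exact: n_neq0.
  rewrite (eq_bigr (fun i => (2 * n%:R)^-1 * (y i i *+ n + \sum_j y j j))); last first.
    by move=> i _; rewrite -mulr_sumr big_split /= sumr_const card_ord.
  rewrite -mulr_sumr big_split /= sumr_const card_ord sumrMnl.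
  move: (\sum_i y i i) => t; rewrite -[t *+ n]mulr_natr.
  by field; exact: n_neq0.
have [k yk] : exists k, 0 < y k k.
  apply/existsP; apply: contraT; rewrite negb_exists => /forallP yn.
  have : \sum_i y i i <= 0.
    by apply: sumr_le0 => i _; rewrite leNgt; exact: yn.
  by rewrite sy ler10.
pose x : 'rV[R]_n := \row_i (y k i / Num.sqrt (y k k)).
have xx i j : x 0 i * x 0 j = y i j.
  rewrite !mxE mulrACA -invfM -expr2 sqr_sqrtr // -yy mulrC mulKf //.
  by rewrite gt_eqF.
exists x; split; first by rewrite -sy; apply: eq_bigr => i _; rewrite expr2 xx.
move=> c; rewrite -{1}(enum_valK c); move: (enum_val c) => [[i j] b].
rewrite zy /peval /zsq rmorphM rmorphXn rmorphD rmorphM /= rmorph_sign mevalC !mevalXU.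
congr (_ * _); rewrite sqrrD exprMn sqrr_sign mul1r !expr2 !xx.
by rewrite -mulr_natl [x 0 i * _]mulrCA xx; ring.
Qed.

End Veronese.

(** * Compactness of the simplex and of the sphere *)

Section Compactness.
Variable R : realType.

Lemma continuous_coordX (N k : nat) (i : 'I_N) :
  continuous (fun z : 'rV[R]_N => z 0 i ^+ k).
Proof.
move=> z; apply: (@continuous_comp _ _ _ (fun z : 'rV[R]_N => z 0 i) (fun x : R => x ^+ k)).
  exact: coord_continuous.
exact: exprn_continuous.
Qed.

Lemma continuous_peval (N : nat) (F : mpolynomial R N) : continuous (peval F).
Proof.
rewrite (_ : peval F = fun z => \sum_(w <- msupp F) mcoeff w F * \prod_i z 0 i ^+ w i).
  apply: continuous_sum => w.
  have mc : continuous (fun z : 'rV[R]_N => \prod_i z 0 i ^+ w i).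
    by apply: continuous_prod => i; exact: continuous_coordX.
  by move=> z; exact: (continuousM (@cst_continuous _ _ (mcoeff w F) z) (mc z)).
by apply/funext => z; rewrite /peval mevalE.
Qed.

Lemma compact_box_level (N : nat) (lo : R) (F : 'rV[R]_N -> R) : continuous F ->
  compact [set z : 'rV[R]_N | (forall i, `[lo, 1] (z 0 i)) /\ F z = 1].
Proof.
move=> Fc; pose box := [set z : 'rV[R]_N | forall i, `[lo, 1] (z 0 i)].
have -> : [set z : 'rV[R]_N | (forall i, `[lo, 1] (z 0 i)) /\ F z = 1] =
    box `&` F @^-1` [set 1].
  by apply/seteqP; split.
apply: compact_closedI.
  by apply: (rV_compact (A := fun=> `[lo, 1])) => _; exact: segment_compact.
exact: (preimage_closed (in1W Fc) (@closed_eq R 1)).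
Qed.

Definition std_simplex (N : nat) : set 'rV[R]_N :=
  [set z | (forall i, 0 <= z 0 i) /\ \sum_i z 0 i = 1].

Definition unit_sphere (N : nat) : set 'rV[R]_N := [set v | \sum_i v 0 i ^+ 2 = 1].

Lemma compact_simplex N : compact (@std_simplex N).
Proof.
have -> : @std_simplex N =
    [set z | (forall i, `[0, 1] (z 0 i)) /\ \sum_i z 0 i = 1].
  apply/seteqP; split=> z [z0 z1]; split=> // i; last first.
    by have := z0 i; rewrite /= in_itv /= => /andP[].
  rewrite /= in_itv /= z0 -z1 (bigD1 i) //= lerDl.
  by apply: sumr_ge0.
apply: compact_box_level; apply: continuous_sum => i; exact: coord_continuous.
Qed.

Lemma compact_sphere N : compact (@unit_sphere N).
Proof.
have -> : @unit_sphere N =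
    [set z | (forall i, `[-1, 1] (z 0 i)) /\ \sum_i z 0 i ^+ 2 = 1].
  apply/seteqP; split=> [z z1|z []//]; split=> // i.
  rewrite /= in_itv /= -ler_norml -(@ler_pXn2r _ 2) ?nnegrE // expr1n real_normK ?num_real //.
  by rewrite -[leRHS]z1 (bigD1 i) //= lerDl sumr_ge0 // => j _; rewrite sqr_ge0.
by apply: compact_box_level; apply: continuous_sum => i; exact: continuous_coordX.
Qed.

End Compactness.

(** * The sparse certificate for a positive definite form *)

Section Positivstellensatz.
Variables (R : realType) (n m q : nat) (e : rel 'I_m).
Hypotheses (n_gt0 : (0 < n)%N) (e_sym : ssrbool.symmetric e) (e_irr : irreflexive e)
  (e_chordal : chordal e).
Variables (P : 'M[mpolynomial R n]_m) (g : 'I_q -> mpolynomial R n).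
Variables (dP : nat) (dg : 'I_q -> nat).
Hypotheses (P_sym : forall i j, P i j = P j i)
  (P_sparse : forall i j, i != j -> ~~ e i j -> P i j = 0)
  (P_homog : forall i j, homogeneous dP.*2 (P i j))
  (g_homog : forall j, homogeneous (dg j).*2 (g j))
  (P_pd : forall x, semialgebraic_set g x -> x != 0 -> pos_def (mxeval P x)).

Notation index := ('I_n * 'I_n * bool)%type.
Notation N := #|{: index}|.
Notation rels := (index + 'I_n * 'I_n * 'I_n)%type.
Notation sum_vars := (\sum_k mpolyX R (mnm1 k) : mpolynomial R N).

(* An equation r = 0 is imposed as the inequality - r ^+ 2 >= 0. *)
Definition constraint (j : 'I_q + rels) : mpolynomial R N :=
  match j with inl j => lift_form (g j) | inr r => - (zrel R r) ^+ 2 end.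

Definition constraint_deg (j : 'I_q + rels) : nat :=
  match j with inl j => dg j | inr r => zrel_deg r * 2 end.

Lemma homog_constraint j : homogeneous (constraint_deg j) (constraint j).
Proof.
case: j => [j|r] /=; first exact: homog_lift.
by rewrite /homogeneous rpredN; apply: homogX; exact: homog_zrel.
Qed.

Lemma homog_sum_vars : homogeneous 1 sum_vars.
Proof. by apply: rpred_sum => k _; rewrite dhomogX /= mdeg1. Qed.

Lemma peval_sum_vars (z : 'rV[R]_N) : peval sum_vars z = \sum_k z 0 k.
Proof.
by rewrite /peval raddf_sum /=; apply: eq_bigr => k _; rewrite mevalXU.
Qed.

(** Treating [v] as a second compact variable reduces definiteness of a matrix to positivity of a
    scalar. On unit vectors a scalar penalty is the form of a multiple of the identity. *)
Lemma lifted_penalty : exists c M k c0, [/\ 0 <= c, 0 < c0 &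
  forall (z : 'rV[R]_N) (v : 'rV[R]_m), std_simplex z -> unit_sphere v ->
    c0 <= \sum_i \sum_j v 0 i * v 0 j * peval (lift_form (P i j)) z
          - c * \sum_j peval (constraint j) z * (M - peval (constraint j) z) ^+ k.*2].
Proof.
pose T : topologicalType := ('rV[R]_N * 'rV[R]_m)%type.
pose D : set T := @std_simplex R N `*` @unit_sphere R m.
have cD : compact D by apply: compact_setX; [exact: compact_simplex|exact: compact_sphere].
have cfst (F : mpolynomial R N) : continuous (fun t : T => peval F t.1).
  move=> t; apply: (@continuous_comp _ _ _ (fst : T -> 'rV[R]_N) (peval F)).
    exact: cvg_fst.
  exact: continuous_peval.
have csnd i : continuous (fun t : T => t.2 0 i).
  move=> t; apply: (@continuous_comp _ _ _ (snd : T -> 'rV[R]_m) (fun v => v 0 i)).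
    exact: cvg_snd.
  exact: coord_continuous.
pose f (t : T) := \sum_i \sum_j t.2 0 i * t.2 0 j * peval (lift_form (P i j)) t.1.
have fc : continuous f.
  apply: continuous_sum => i; apply: continuous_sum => j t.
  exact: (continuousM (continuousM (csnd i t) (csnd j t)) (cfst _ t)).
have [|c [M [k [c0 [cge c0gt H]]]]] :=
    penalty (f := f) (h := fun j t => peval (constraint j) t.1) cD fc (fun j => cfst _).
  move=> [z v] [[/= z0 z1] v1] hz.
  have [|x [x1 zx]] := veronese_pt n_gt0 z0 z1.
    move=> r; have := hz (inr r); rewrite /peval /= rmorphN rmorphXn /= oppr_ge0 => h.
    by apply/eqP; rewrite -sqrf_eq0 eq_le h sqr_ge0.
  have evx F : peval F z = peval (veronese F) x.
    by rewrite meval_veronese /peval; apply: meval_eq.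
  have gx : semialgebraic_set g x.
    move=> j; have := hz (inl j).
    by rewrite /= evx (veronese_lift n_gt0 (g_homog j)).
  have x0 : x != 0.
    apply/eqP => xE; move: x1; rewrite xE big1 => [/eqP|i _].
      by rewrite eq_sym oner_eq0.
    by rewrite mxE expr0n.
  have v0 : v^T != 0.
    apply/eqP => /(congr1 trmx); rewrite trmxK trmx0 => vE.
    move: v1; rewrite /unit_sphere /= vE big1 => [/eqP|i _].
      by rewrite eq_sym oner_eq0.
    by rewrite mxE expr0n.
  have := P_pd gx x0 v0; rewrite form_sum; congr (0 < _).
  apply: eq_bigr => i _; apply: eq_bigr => j _; rewrite !mxE evx.
  by rewrite (veronese_lift n_gt0 (P_homog i j)).
exists c, M, k, c0; split=> // z v zs vs.
exact: (H (z, v) (conj zs vs)).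
Qed.

Theorem sparse_positivstellensatz : exists nu0, forall nu, (nu0 <= nu)%N ->
  (forall j, (dg j <= nu + dP)%N) /\
  exists M0 M, [/\ sparse_sos e (nu + dP) M0,
    forall j, sparse_sos e (nu + dP - dg j) (M j) &
    sqnormX R n ^+ nu *: P = M0 + \sum_j g j *: M j].
Proof.
have [c [M [k [c0 [c_ge0 c0_gt0 H]]]]] := lifted_penalty.
pose E := \max_j constraint_deg j.
have degE j : (constraint_deg j <= E)%N by exact: leq_bigmax.
(* The exponents homogenize: [A + dP] is the degree of the lifted matrix times [sum_vars ^+ A], and
   [B j] raises the penalty of the constraint [j] to that degree. *)
pose A := (k.*2.+1 * E)%N.
pose B j := (k.*2.+1 * (E - constraint_deg j) + dP)%N.
pose pen j : mpolynomial R N := sum_vars ^+ B j *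
  (mpolyC N M * sum_vars ^+ constraint_deg j - constraint j) ^+ k.*2.
pose pensum : mpolynomial R N := mpolyC N c * \sum_j constraint j * pen j.
pose F : 'M[mpolynomial R N]_m :=
  \matrix_(i, j) (sum_vars ^+ A * lift_form (P i j) - (i == j)%:R * pensum).
have sum_varsX d : homogeneous d (sum_vars ^+ d).
  by rewrite -{1}[d]mul1n; apply: homogX; exact: homog_sum_vars.
have F_homog i j : homogeneous (A + dP) (F i j).
  rewrite mxE; apply: rpredB.
    by apply: homogM; [exact: sum_varsX|exact: homog_lift].
  rewrite mulr_natl; apply: rpredMn; apply: homogCM; apply: rpred_sum => r _.
  have -> : (A + dP = constraint_deg r + (B r + constraint_deg r * k.*2))%N.
    by rewrite /A /B; have := degE r; move: (constraint_deg r) => x xE; nia.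
  apply: homogM; first exact: homog_constraint.
  apply: homogM; first exact: sum_varsX.
  apply: homogX; apply: rpredB; last exact: homog_constraint.
  exact/homogCM/sum_varsX.
have F_pd (z : 'rV[R]_N) : (forall i, 0 <= z 0 i) -> \sum_i z 0 i = 1 ->
    forall v : 'cV[R]_m, c0 * \sum_i v i 0 ^+ 2 <= (v^T *m mxeval F z *m v) 0 0.
  move=> z0 z1 v; rewrite form_sum.
  pose s := \sum_i v i 0 ^+ 2; rewrite -/s.
  have s0 : 0 <= s by apply: sumr_ge0 => i _; rewrite sqr_ge0.
  have [sE|sN] := eqVneq s 0.
    have v0 i : v i 0 = 0.
      apply/eqP; rewrite -sqrf_eq0; move/eqP: sE; rewrite psumr_eq0; last first.
        by move=> ? _; rewrite sqr_ge0.
      by move=> /allP/(_ i (mem_index_enum _)).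
    rewrite sE mulr0 big1 // => i _; rewrite big1 // => j _.
    by rewrite v0 !mul0r.
  have s_gt0 : 0 < s by rewrite lt_def sN.
  pose u : 'rV[R]_m := \row_i (v i 0 / Num.sqrt s).
  have uu i j : s * (u 0 i * u 0 j) = v i 0 * v j 0.
    by rewrite !mxE mulrACA -invfM -expr2 sqr_sqrtr // mulrC divfK.
  have u1 : unit_sphere u.
    rewrite /unit_sphere /=; apply: (mulfI sN); rewrite mulr1 mulr_sumr.
    by apply: eq_bigr => i _; rewrite expr2 uu.
  have h := ler_wpM2l s0 (H z u (conj z0 z1) u1).
  rewrite [c0 * s]mulrC; apply: le_trans h _; rewrite mulrBr.
  have pE : peval pensum z = c * \sum_j peval (constraint j) z *
      (M - peval (constraint j) z) ^+ k.*2.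
    rewrite /peval /pensum rmorphM /= mevalC raddf_sum /=; congr (_ * _).
    apply: eq_bigr => r _; rewrite rmorphM /= /pen rmorphM !rmorphXn /=.
    rewrite rmorphB rmorphM rmorphXn /= mevalC.
    have -> : meval (fun i => z 0 i) sum_vars = 1 by rewrite -z1 -peval_sum_vars.
    by rewrite !expr1n mul1r mulr1.
  rewrite -pE.
  have Fz i j : mxeval F z i j =
      peval (lift_form (P i j)) z - (i == j)%:R * peval pensum z.
    rewrite !mxE /peval rmorphB !rmorphM /= rmorphXn /= rmorph_nat.
    have -> : meval (fun i => z 0 i) sum_vars = 1 by rewrite -z1 -peval_sum_vars.
    by rewrite expr1n mul1r.
  under [leRHS]eq_bigr => i _ do (under eq_bigr => j _ do rewrite Fz mulrBr).
  under [leRHS]eq_bigr => i _ do rewrite sumrB.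
  rewrite sumrB lerB //.
    rewrite mulr_sumr ler_sum // => i _; rewrite mulr_sumr ler_sum // => j _.
    by rewrite mulrA uu.
  rewrite /s mulr_suml ler_sum // => i _.
  rewrite (bigD1 i) //= eqxx mul1r big1 ?addr0 ?expr2 // => j ji.
  by rewrite eq_sym (negPf ji) mul0r mulr0.
have [t0 psd] := polya_coef_psd F_homog c0_gt0 F_pd.
(* Of the [nu] factors |x|^2, [A] are already in [F] and [nu - A] come from Polya's theorem, used
   with words of length [nu + dP]. *)
exists (maxn A t0) => nu; rewrite geq_max => /andP[A_nu t0_nu].
have dg_le j : (dg j <= nu + dP)%N.
  by have := degE (inl j); move: A_nu; rewrite /A /=; nia.
split=> //.
have et : (A + dP <= nu + dP)%N by rewrite leq_add2r.
have := polya_coefE F_homog et; rewrite subnDr => polyaE.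
pose M0 := \sum_(w : {ffun 'I_(nu + dP) -> 'I_N})
  (\prod_l zsq R (enum_val (w l))) *: map_mx (@mpolyC n R) (polya_coef (A + dP) F w).
pose pen' j : mpolynomial R n := mpolyC n c * (sqnormX R n ^+ (nu - A + B (inl j)) *
  (mpolyC n M * sqnormX R n ^+ dg j - g j) ^+ k.*2).
exists M0, (fun j => pen' j *: 1%:M); split.
- apply: sparse_sos_sum => w _.
  have -> : \prod_l zsq R (enum_val (w l)) =
      mpolyC n ((4 * n%:R)^-1 ^+ (nu + dP)) *
      (\prod_l (mpolyX R (mnm1 (enum_val (w l)).1.1) +
         (-1) ^+ (enum_val (w l)).2 * mpolyX R (mnm1 (enum_val (w l)).1.2))) ^+ 2.
    rewrite /zsq big_split /= prodr_const card_ord -prodrXl.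
    by rewrite rmorphXn.
  rewrite -scalerA; apply: sparse_sosZ.
    by rewrite exprn_ge0 // invr_ge0 mulr_ge0.
  rewrite -[X in sparse_sos _ X]add0n; apply: sparse_sos_sq.
    rewrite -[leqRHS]muln1 -[X in (_ <= X * _)%N]card_ord.
    apply: pdeg_prod => l; apply: pdeg_homog; apply: rpredD.
      by rewrite dhomogX /= mdeg1.
    by apply: homog_signM; rewrite /homogeneous dhomogX /= mdeg1.
  apply: sparse_sos_psd => //.
  + apply/matrixP => i j; rewrite !mxE; congr (_ * _); apply: eq_bigr => f _.
    by rewrite P_sym eq_sym.
  + by apply: psd; apply: leq_trans t0_nu (leq_addr _ _).
  + move=> i j ij eij; rewrite mxE big1 ?mulr0 // => f _.
    by rewrite mxE P_sparse // lift_form0 (negPf ij) mulr0 mul0r subrr sym_tensor0.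
- move=> j.
  (* The budget is met exactly: [k * (dg j).*2] for the k-th power that gets squared, the rest for
     the power of |x|^2. *)
  have -> : (nu + dP - dg j = 0 + k * (dg j).*2 + (nu - A + B (inl j)))%N.
    have := degE (inl j); move: A_nu; rewrite /A /B /=.
    by move: (dg j) => x A_nu xE; nia.
  rewrite /pen' -!scalerA; apply: sparse_sosZ => //; apply: sparse_sos_sqnorm.
  rewrite -[k.*2]muln2 exprM; apply: sparse_sos_sq.
    apply: pdegX; apply: pdeg_homog; apply: rpredB; last exact: g_homog.
    by apply: homogCM; rewrite -mul2n; apply: homogX; exact: homog_sqnorm.
  rewrite -(map_mx1 (@mpolyC n R)); apply: sparse_sos_psd => //.
  + exact: trmx1.
  + move=> v; rewrite form_sum; apply: sumr_ge0 => i _.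
    rewrite (bigD1 i) //= big1 ?addr0 => [|j' ji].
      by rewrite mxE eqxx mulr1 -expr2 sqr_ge0.
    by rewrite mxE eq_sym (negPf ji) mulr0.
  + by move=> i j' ij _; rewrite mxE (negPf ij).
- apply/matrixP => i j.
  have := congr1 (fun K : 'M[mpolynomial R N]_m => veronese (K i j)) polyaE.
  have FE : veronese (F i j) =
      sqnormX R n ^+ A * P i j - (i == j)%:R * veronese pensum.
    rewrite mxE rmorphB; congr (_ - _); last by rewrite rmorphM rmorph_nat.
    by rewrite rmorphM rmorphXn /= (veronese_sum R n_gt0) (veronese_lift n_gt0 (P_homog i j)).
  rewrite [in X in X = _]mxE rmorphM rmorphXn /= (veronese_sum R n_gt0) FE => h.
  have M0E : veronese ((\sum_(w : {ffun 'I_(nu + dP) -> 'I_N})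
      (\prod_l mpolyX R (mnm1 (w l))) *: map_mx (@mpolyC N R) (polya_coef (A + dP) F w)) i j) =
      M0 i j.
    rewrite !summxE raddf_sum /=; apply: eq_bigr => w _.
    rewrite [in LHS]mxE [in RHS]mxE rmorphM rmorph_prod /=; congr (_ * _).
      by apply: eq_bigr => l _; rewrite /veronese mmapX mmap1U.
    by rewrite mxE [in RHS]mxE veroneseC.
  rewrite M0E in h.
  have penE : veronese pensum = \sum_(j < q) g j * (mpolyC n c *
      (sqnormX R n ^+ B (inl j) *
        (mpolyC n M * sqnormX R n ^+ dg j - g j) ^+ k.*2)).
    rewrite /pensum rmorphM /= veroneseC raddf_sum /= big_sumType /=.
    (* The penalties of the equations vanish upon substituting z(x), so they leave no trace in the
       certificate. *)
    rewrite [X in _ + X]big1 ?addr0 => [|r _]; last first.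
      by rewrite rmorphM rmorphN rmorphXn /= veronese_zrel // expr0n oppr0 mul0r.
    rewrite mulr_sumr; apply: eq_bigr => r _.
    rewrite rmorphM /pen rmorphM !rmorphXn rmorphB rmorphM rmorphXn /= veroneseC.
    rewrite (veronese_sum R n_gt0).
    rewrite (veronese_lift n_gt0 (g_homog r)).
    exact: mulrCA.
  rewrite [LHS]mxE [RHS]mxE -h summxE penE mulrBr mulrA -exprD subnK // -addrA.
  rewrite [X in _ = _ + X](_ : _ = 0) ?addr0 //.
  apply/eqP; rewrite addrC subr_eq0; apply/eqP.
  rewrite !mulr_sumr; apply: eq_bigr => r _.
  rewrite 3!mxE -mulr_natr mul1r /pen' exprD.
  move: (sqnormX R n ^+ (nu - A)) (sqnormX R n ^+ B (inl r)) => x y.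
  move: ((mpolyC n M * _ - _) ^+ _) => z.
  by ring.
Qed.

End Positivstellensatz.

(** * Dependence of the pencil on lambda *)

Section Pencil.
Variables (R : realType) (n m l q : nat).
Variables (P0 : 'M[mpolynomial R n]_m) (Ps : 'I_l -> 'M[mpolynomial R n]_m).
Variable g : 'I_q -> mpolynomial R n.

Lemma pencilE lam i j :
  pencil P0 Ps lam i j = P0 i j - \sum_k lam 0 k *: Ps k i j.
Proof.
rewrite !mxE summxE; congr (_ - _); apply: eq_bigr => k _.
by rewrite mxE mul_mpolyC.
Qed.

Lemma pencil_conv (t : R) lam lam' i j :
  pencil P0 Ps (t *: lam + (1 - t) *: lam') i j =
  t *: pencil P0 Ps lam i j + (1 - t) *: pencil P0 Ps lam' i j.
Proof.
rewrite !pencilE !scalerBr addrACA -opprD -scalerDl [t + _]addrC subrK scale1r.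
congr (_ - _); rewrite !scaler_sumr -big_split /=; apply: eq_bigr => k _.
by rewrite !mxE scalerDl !scalerA.
Qed.

Lemma mxeval_pencil_conv (t : R) lam lam' x :
  mxeval (pencil P0 Ps (t *: lam + (1 - t) *: lam')) x =
  t *: mxeval (pencil P0 Ps lam) x + (1 - t) *: mxeval (pencil P0 Ps lam') x.
Proof.
have ev lam'' i j : mxeval (pencil P0 Ps lam'') x i j = peval (pencil P0 Ps lam'' i j) x.
  by rewrite mxE.
have comb (a c : R) (p p' : mpolynomial R n) :
    peval (a *: p + c *: p') x = a * peval p x + c * peval p' x.
  by rewrite /peval mevalD !mevalZ.
apply/matrixP => i j; rewrite ev (pencil_conv t lam lam' i j) comb -!ev.
by rewrite [RHS]mxE; congr (_ + _); rewrite [RHS]mxE.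
Qed.

Lemma pencil_tr lam : P0^T = P0 -> (forall i, (Ps i)^T = Ps i) ->
  forall i j, pencil P0 Ps lam i j = pencil P0 Ps lam j i.
Proof.
move=> P0s Pss i j; rewrite !pencilE -[in LHS]P0s mxE; congr (_ - _).
by apply: eq_bigr => k _; rewrite -[in LHS]Pss mxE.
Qed.

Lemma pdeg_pencil lam i j : (pdeg (pencil P0 Ps lam i j) <= pencil_deg P0 Ps)%N.
Proof.
rewrite pencilE -sumrN; apply: pdegD.
  by move: i j; apply/mxdeg_leqP; exact: leq_maxl.
apply: pdeg_sum => k _; rewrite -scaleNr -mul_mpolyC -[pencil_deg _ _]add0n.
apply: pdegM; first by rewrite pdegC.
move: i j; apply/mxdeg_leqP; apply: leq_trans (leq_maxr _ _).
exact: (leq_bigmax (F := fun k => mxdeg (Ps k)) k).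
Qed.

(** The coefficients of the pencil are its value at 0 and the differences of that value with those
    at the basis vectors, so pencils that are all constant have constant coefficients. *)
Lemma pencil_deg_gt0 : (0 < pencil_deg P0 Ps)%N ->
  exists lam i j, (0 < pdeg (pencil P0 Ps lam i j))%N.
Proof.
apply: contraPP => /forallNP h; apply/negP; rewrite -leqNgt.
have h0 lam i j : (pdeg (pencil P0 Ps lam i j) <= 0)%N.
  rewrite leqNgt; apply/negP => lt0; apply: (h lam).
  by exists i, j.
have P0E i j : P0 i j = pencil P0 Ps 0 i j.
  by rewrite pencilE big1 ?subr0 // => k _; rewrite mxE scale0r.
have PsE k i j : Ps k i j = pencil P0 Ps 0 i j + mpolyC n (-1) * pencil P0 Ps (delta_mx 0 k) i j.
  rewrite -P0E pencilE (bigD1 k) //= mxE !eqxx scale1r big1 ?addr0; last first.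
    by move=> k' kk; rewrite mxE (negPf kk) andbF scale0r.
  by rewrite mul_mpolyC scaleN1r opprB addrC subrK.
rewrite geq_max; apply/andP; split; first by apply/mxdeg_leqP => i j; rewrite P0E.
apply/bigmax_leqP => k _; apply/mxdeg_leqP => i j; rewrite PsE.
by apply: pdegD => //; apply: (pdegM (d := 0) (d' := 0)); rewrite ?pdegC.
Qed.

Hypothesis P_homog : forall lam, even_homogeneous_mx (pencil P0 Ps lam).

(* Two nonzero pencils have the same degree, as their midpoint is homogeneous. *)
Lemma pencil_eval0 lam : (0 < pencil_deg P0 Ps)%N ->
  mxeval (pencil P0 Ps lam) 0 = 0.
Proof.
move=> /pencil_deg_gt0[lam' [a [c dpos]]]; apply/matrixP => i j; rewrite [LHS]mxE [RHS]mxE.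
have [k _ hk] := P_homog lam; have [k' _ hk'] := P_homog lam'.
have ev : peval (pencil P0 Ps lam i j) 0 = 0 ^+ k * peval (pencil P0 Ps lam i j) 0.
  rewrite /peval -(meval_homog _ _ (hk i j)); apply: meval_eq => r.
  by rewrite mxE mul0r.
(* Only degree 0 allows a nonzero value at 0; it is played off against the nonconstant pencil at
   [lam']. *)
rewrite ev; case: k hk {ev} => [|k] hk; last by rewrite expr0n mul0r.
apply/eqP; rewrite expr0 mul1r; apply: contraT => evN.
have k'E : pdeg (pencil P0 Ps lam' a c) = k'.
  apply: homog_pdeg => //; apply: contraTneq dpos => ->.
  by rewrite /pdeg mmeasure0.
have pN : pencil P0 Ps lam i j != 0.
  by apply: contraNneq evN => ->; rewrite /peval meval0.
have p'N : pencil P0 Ps lam' a c != 0.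
  by apply: contraTneq dpos => ->; rewrite /pdeg mmeasure0.
have [k'' _ hk''] := P_homog (2^-1 *: lam + (1 - 2^-1) *: lam').
pose w := mlead (pencil P0 Ps lam i j).
pose w' := mlead (pencil P0 Ps lam' a c).
have dw : mdeg w = 0%N by apply: (dhomogP _ _ _ (hk i j)); exact: mlead_supp.
have dw' : mdeg w' = k' by apply: (dhomogP _ _ _ (hk' a c)); exact: mlead_supp.
have k'pos : (0 < k')%N by rewrite -k'E.
have half : (1 - 2^-1 : R) != 0.
  by rewrite subr_eq0 eq_sym invr_eq1 (eqr_nat _ 2 1).
have e0 : k'' = 0%N.
  rewrite -dw; apply/esym/(dhomogP _ _ _ (hk'' i j)); rewrite mcoeff_msupp pencil_conv.
  rewrite mcoeffD !mcoeffZ (dhomog_nemf_coeff (hk' i j)) ?mulr0 ?addr0.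
    by rewrite mulf_neq0 ?invr_eq0 ?pnatr_eq0 // -mcoeff_msupp mlead_supp.
  by rewrite /= dw eq_sym -lt0n.
have : k'' = k'.
  rewrite -dw'; apply/esym/(dhomogP _ _ _ (hk'' a c)); rewrite mcoeff_msupp pencil_conv.
  rewrite mcoeffD !mcoeffZ (dhomog_nemf_coeff (hk a c)) ?mulr0 ?add0r.
    by rewrite mulf_neq0 // -mcoeff_msupp mlead_supp.
  by rewrite /= dw' -lt0n.
by move=> kk; rewrite -kk e0 in k'pos.
Qed.

End Pencil.

(** * Evaluation at a point *)

Section Evaluation.
Variables (R : realType) (n : nat) (x : 'rV[R]_n).

Definition evmx (a c : nat) (M : 'M[mpolynomial R n]_(a, c)) : 'M[R]_(a, c) :=
  map_mx (meval (fun i => x 0 i)) M.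

Lemma sos_mx_psd (a : nat) (M : 'M[mpolynomial R n]_a) :
  sos_mx M -> pos_semidef (evmx M).
Proof.
move=> [r [H ->]] v; rewrite /evmx map_mxM -map_trmx mulmxA -trmx_mul -mulmxA.
by rewrite mxE; apply: sumr_ge0 => i _; rewrite !mxE -expr2 sqr_ge0.
Qed.

Lemma evmx_clique (a : nat) (C : {set 'I_a}) :
  evmx (clique_mx _ C) = clique_mx R C.
Proof. by apply/matrixP => i j; rewrite !mxE rmorph_nat. Qed.

Lemma peval_sqnorm_gt0 : x != 0 -> 0 < peval (sqnormX R n) x.
Proof.
move=> x0; rewrite /peval raddf_sum /=.
have pE i : meval (fun j => x 0 j) (mpolyX R (mnm1 i) ^+ 2) = x 0 i ^+ 2.
  by rewrite rmorphXn /= mevalXU.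
under eq_bigr do rewrite pE.
rewrite lt_def sumr_ge0 ?andbT => [|i _]; last by rewrite sqr_ge0.
apply: contra x0; rewrite psumr_eq0 => [/allP xi|i _]; last by rewrite sqr_ge0.
apply/eqP/rowP => i; rewrite mxE; apply/eqP; rewrite -sqrf_eq0.
exact: xi (mem_index_enum _).
Qed.

End Evaluation.

(** * The relaxation and the original problem *)

Section Relaxation.
Variables (R : realType) (n m l q : nat).
Variables (P0 : 'M[mpolynomial R n]_m) (Ps : 'I_l -> 'M[mpolynomial R n]_m).
Variable g : 'I_q -> mpolynomial R n.
Hypotheses (P_homog : forall lam, even_homogeneous_mx (pencil P0 Ps lam))
  (P_nonconst : semialgebraic_set g = [set 0] -> (0 < pencil_deg P0 Ps)%N).

Lemma sos_feasible_sub d nu :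
  sos_feasible P0 Ps g (sqnormX R n) d nu `<=` pmi_feasible P0 Ps g.
Proof.
move=> lam [S0 [S [S0sos Ssos PE]]].
have psd x : semialgebraic_set g x -> x != 0 ->
    pos_semidef (mxeval (pencil P0 Ps lam) x).
  move=> gx x0 v; have s0 := peval_sqnorm_gt0 x0.
  rewrite -(pmulr_rge0 _ (exprn_gt0 nu s0)).
  have -> : peval (sqnormX R n) x ^+ nu *
      (v^T *m mxeval (pencil P0 Ps lam) x *m v) 0 0 =
      (v^T *m evmx x (sqnormX R n ^+ nu *: pencil P0 Ps lam) *m v) 0 0.
    have -> : evmx x (sqnormX R n ^+ nu *: pencil P0 Ps lam) =
        peval (sqnormX R n) x ^+ nu *: mxeval (pencil P0 Ps lam) x.
      apply/matrixP => i j.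
      by rewrite [LHS]mxE [X in meval _ X]mxE rmorphM rmorphXn /= [RHS]mxE [in RHS]mxE.
    by rewrite -scalemxAr -scalemxAl [in RHS]mxE.
  rewrite PE /evmx raddf_sum /= mulmx_sumr mulmx_suml summxE.
  apply: sumr_ge0 => C Cm; rewrite !map_mxM -map_trmx -!/(evmx x _).
  rewrite evmx_clique !mulmxA -[v^T *m _]trmxK trmx_mul !trmxK -mulmxA.
  set u := _ *m v; rewrite {1}/evmx raddfD /= mulmxDr mulmxDl mxE addr_ge0 //.
    by apply: sos_mx_psd; have [] := S0sos C Cm.
  rewrite raddf_sum /= mulmx_sumr mulmx_suml summxE; apply: sumr_ge0 => j _.
  have -> : map_mx (meval (fun i => x 0 i)) (g j *: S j C) =
      peval (g j) x *: evmx x (S j C).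
    by apply/matrixP => a c; rewrite !mxE rmorphM.
  rewrite -scalemxAr -scalemxAl mxE; apply: mulr_ge0; first exact: (gx j).
  by apply: sos_mx_psd; have [] := Ssos j C Cm.
move=> x gx; have [->|x0] := eqVneq x 0; last exact: psd.
(* At 0, where |x|^2 vanishes: if K has another point [y], homogeneity makes P(0) a nonnegative
   multiple of P(y); if K is {0}, the pencil vanishes at 0 by [pencil_eval0]. *)
have [[y [gy y0]]|ny] := pselect (exists y, semialgebraic_set g y /\ y != 0).
  move=> v; have [k _ hk] := P_homog lam.
  have -> : mxeval (pencil P0 Ps lam) 0 = 0 ^+ k *: mxeval (pencil P0 Ps lam) y.
    apply/matrixP => i j; rewrite [LHS]mxE [RHS]mxE [in RHS]mxE /peval.
    rewrite -(meval_homog _ _ (hk i j)); apply: meval_eq => r.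
    by rewrite mxE mul0r.
  by rewrite -scalemxAr -scalemxAl mxE mulr_ge0 ?exprn_ge0 //; exact: psd.
rewrite pencil_eval0 //; first by move=> v; rewrite mulmx0 mul0mx mxE.
apply: P_nonconst; apply/seteqP; split=> y /= gy.
  by apply/eqP/negPn/negP => y0; apply: ny; exists y.
have [xE|x0] := eqVneq x 0; first by rewrite gy -xE.
by case: ny; exists x.
Qed.

Hypotheses (P0_sym : P0^T = P0) (Ps_sym : forall i, (Ps i)^T = Ps i)
  (P_chordal : chordal (sparsity_graph P0 Ps))
  (g_homog : forall j, even_homogeneous (g j)).

Notation D := (maxn (pencil_deg P0 Ps) (\max_(j < q) pdeg (g j)))./2.

Lemma sparsity_graph_sym : ssrbool.symmetric (sparsity_graph P0 Ps).
Proof.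
move=> i j; rewrite /sparsity_graph eq_sym; congr (_ && ~~ _).
by apply: asbool_equiv_eq; split=> h lam; rewrite pencil_tr.
Qed.

Lemma sparsity_graph_irr : irreflexive (sparsity_graph P0 Ps).
Proof. by move=> i; rewrite /sparsity_graph eqxx. Qed.

Lemma pencil_sparse lam i j :
  i != j -> ~~ sparsity_graph P0 Ps i j -> pencil P0 Ps lam i j = 0.
Proof. by move=> ij; rewrite /sparsity_graph ij negbK => /asboolP. Qed.

Lemma constraint_homog j :
  homogeneous (pdeg (g j))./2.*2 (g j) /\ uphalf (pdeg (g j)) = (pdeg (g j))./2.
Proof.
have [g0|gN] := eqVneq (g j) 0.
  by rewrite g0 /pdeg mmeasure0; split=> //; exact: dhomog0.
have [k ke hk] := g_homog j; rewrite (homog_pdeg hk gN) uphalf_half (negbTE ke).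
by split=> //; rewrite even_halfK.
Qed.

Lemma sos_feasible_zero sigma d nu lam :
  sigma ^+ nu *: pencil P0 Ps lam = 0 -> sos_feasible P0 Ps g sigma d nu lam.
Proof.
move=> PE; exists (fun=> 0), (fun _ => fun=> 0); split.
- by move=> C _; exact: sos_cone0.
- by move=> j C _; exact: sos_cone0.
- rewrite PE big1 // => C _; rewrite big1 ?addr0 ?mulmx0 ?mul0mx // => j _.
  by rewrite scaler0.
Qed.

Lemma sos_feasible_eventually lam :
  (forall x, semialgebraic_set g x -> x != 0 -> pos_def (mxeval (pencil P0 Ps lam) x)) ->
  exists nu0, forall nu, (nu0 <= nu)%N ->
    sos_feasible P0 Ps g (sqnormX R n) (nu + D) nu lam.
Proof.
(* Without variables |x|^2 is the zero polynomial, and from [nu = 1] on the identity reads 0 = 0. *)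
move=> pd; have [n0|n_gt0] := posnP n.
  exists 1%N => nu nu1; apply: sos_feasible_zero.
  have -> : sqnormX R n = 0.
    by rewrite /sqnormX big1 // => -[i i_lt]; exfalso; move: i_lt; rewrite n0.
  by rewrite expr0n eqn0Ngt nu1 scale0r.
(* The zero pencil is homogeneous of every degree; it takes a nonzero entry to bound the degree [k]
   by [pencil_deg]. *)
have [/existsP[i /existsP[j pN]]|p0] := boolP [exists i, exists j, pencil P0 Ps lam i j != 0];
  last first.
  exists 0%N => nu _; apply: sos_feasible_zero.
  suff -> : pencil P0 Ps lam = 0 by rewrite scaler0.
  apply/matrixP => i j; rewrite [RHS]mxE; apply/eqP; apply: contraNT p0 => pN.
  by apply/existsP; exists i; apply/existsP; exists j.
have [k ke hk] := P_homog lam.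
have kD : (k./2 <= D)%N.
  apply: half_leq; apply: leq_trans (leq_maxl _ _).
  by rewrite -(homog_pdeg (hk i j) pN) pdeg_pencil.
have [] := @sparse_positivstellensatz R n m q (sparsity_graph P0 Ps) n_gt0
  sparsity_graph_sym sparsity_graph_irr P_chordal (pencil P0 Ps lam) g k./2
  (fun j => (pdeg (g j))./2).
- by move=> a c; exact: pencil_tr.
- by move=> a c; exact: pencil_sparse.
- by move=> a c; rewrite even_halfK //; exact: hk.
- by move=> r; have [] := constraint_homog r.
- exact: pd.
move=> nu0 H; exists nu0 => nu /H [dg_le [M0 [M [[S0 S0sos ->] Msos PE]]]].
have [S Ssos] : exists S : 'I_q -> forall C : {set 'I_m}, 'M[mpolynomial R n]_#|C|,
    forall r, (forall C, maximal_clique (sparsity_graph P0 Ps) C ->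
      sos_cone (nu + k./2 - (pdeg (g r))./2) (S r C)) /\
      M r = clique_sum (sparsity_graph P0 Ps) (S r).
  have /fin_all_exists : forall r, exists S : forall C : {set 'I_m}, 'M[mpolynomial R n]_#|C|,
    (forall C, maximal_clique (sparsity_graph P0 Ps) C ->
      sos_cone (nu + k./2 - (pdeg (g r))./2) (S C)) /\
      M r = clique_sum (sparsity_graph P0 Ps) S.
    by move=> r; have [S h1 h2] := Msos r; exists S.
  by [].
exists S0, S; split.
- by move=> C /S0sos; apply: sos_coneW; rewrite leq_add2l.
- move=> r C Cm; have [h _] := Ssos r; apply: sos_coneW (h C Cm).
  have [_ ->] := constraint_homog r.
  by apply: leq_sub2r; rewrite leq_add2l.
- rewrite PE /clique_sum (eq_bigr (fun r => g r *: clique_sum (sparsity_graph P0 Ps) (S r))).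
    rewrite /clique_sum; under [X in _ + X]eq_bigr do rewrite scaler_sumr.
    rewrite exchange_big -big_split /=; apply: eq_bigr => C _.
    rewrite mulmxDr mulmxDl mulmx_sumr mulmx_suml; congr (_ + _).
    by apply: eq_bigr => r _; rewrite -scalemxAr -scalemxAl.
  by move=> r _; have [_ ->] := Ssos r.
Qed.

End Relaxation.

Lemma convex_lt_combination (R : realType) (l : nat) (b : 'rV[R]_l -> R)
    (lam lam0 : 'rV[R]_l) (eps : R) :
  convex_function setT b -> 0 < eps ->
  exists t : R, [/\ 0 < t, t <= 1 & b (t *: lam0 + (1 - t) *: lam) <= b lam + eps].
Proof.
move=> bc eps0; pose K := `|b lam0 - b lam| + 1.
have K0 : 0 < K by rewrite ltr_wpDl.
pose t := Num.min 1 (eps / K).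
have t0 : 0 < t by rewrite lt_min ltr01 divr_gt0.
have t1 : t <= 1 by rewrite ge_min lexx.
exists t; split=> //.
have h : b (t *: lam0 + (1 - t) *: lam) <= t * b lam0 + (1 - t) * b lam.
  exact: bc (Itv01 (ltW t0) t1) lam0 lam (mem_set I) (mem_set I).
apply: le_trans h _.
have -> : t * b lam0 + (1 - t) * b lam = b lam + t * (b lam0 - b lam) by ring.
rewrite lerD2l; apply: le_trans (_ : t * K <= _).
  by rewrite ler_wpM2l ?(ltW t0) // (le_trans (ler_norm _)) // lerDl.
by rewrite -ler_pdivlMr // ge_min lexx orbT.
Qed.

Theorem theorem3p2 (R : realType) (n m l q : nat)
    (b : 'rV[R]_l -> R)
    (P0 : 'M[mpolynomial R n]_m) (Ps : 'I_l -> 'M[mpolynomial R n]_m)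
    (g : 'I_q -> mpolynomial R n)
    (b_convex : convex_function setT b)
    (P0_sym : P0^T = P0) (Ps_sym : forall i, (Ps i)^T = Ps i)
    (P_chordal : chordal (sparsity_graph P0 Ps))
    (P_homog : forall lam, even_homogeneous_mx (pencil P0 Ps lam))
    (g_homog : forall j, even_homogeneous (g j))
    (* excludes constant P when K is {0}, e.g. the vacuous case n = 0 *)
    (P_nonconst : semialgebraic_set g = [set 0] -> (0 < pencil_deg P0 Ps)%N)
    (P_pos : exists lam0 : 'rV[R]_l, forall x : 'rV[R]_n,
       semialgebraic_set g x -> x != 0 ->
       pos_def (mxeval (pencil P0 Ps lam0) x)) :
  let d nu :=
    (nu + (maxn (pencil_deg P0 Ps) (\max_(j < q) pdeg (g j)))./2)%N in
  let B nu := sos_value b P0 Ps g (sqnormX R n) (d nu) nu in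
  (forall nu : nat, (pmi_value b P0 Ps g <= B nu)%E) /\
  B nu @[nu --> \oo] --> pmi_value b P0 Ps g.
Proof.
move=> d B.
have le_B nu : (pmi_value b P0 Ps g <= B nu)%E.
  by apply: ereal_inf_le_tmp; apply: image_subset; exact: sos_feasible_sub.
(* As every [B nu] lies above the claimed limit, only the limit superior remains to be bounded, by
   [b lam + eps] for each feasible [lam]. *)
split=> //; apply: limn_esup_le_cvg => //.
apply: le_ereal_inf_tmp => _ [lam lam_feas <-].
apply/lee_addgt0Pr => eps eps0; rewrite -EFinD.
have [lam0 P_pd] := P_pos.
have [t [t0 t1 bt]] := convex_lt_combination lam lam0 b_convex eps0.
pose lamt := t *: lam0 + (1 - t) *: lam.
have lamt_pd x : semialgebraic_set g x -> x != 0 ->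
    pos_def (mxeval (pencil P0 Ps lamt) x).
  move=> gx x0 v v0.
  rewrite mxeval_pencil_conv form_comb; apply: ltr_pwDl.
    by apply: mulr_gt0 => //; exact: P_pd.
  by apply: mulr_ge0; [rewrite subr_ge0|exact: lam_feas].
have [nu0 feas] := sos_feasible_eventually P_homog P0_sym Ps_sym P_chordal g_homog lamt_pd.
(* The limit superior is at most the supremum over any tail, and on this one [lamt] is feasible
   throughout. *)
apply: le_trans (_ : ereal_sup [set B nu | nu in [set nu | (nu0 <= nu)%N]] <= _)%E.
  apply: ereal_inf_lbound; exists [set nu | (nu0 <= nu)%N] => //.
  exact: nbhs_infty_ge.
apply: ge_ereal_sup => _ [nu /= nu_ge <-].
apply: le_trans (_ : (b lamt)%:E <= _)%E; last by rewrite lee_fin.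
by apply: ereal_inf_lbound; exists lamt => //; exact: feas.
Qed.
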